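(* Let $K$ be an imaginary quadratic field. The space $F(\mathcal{E}ll(\mathcal O_K))$ contains the Hecke theta function $\vartheta(\tau;\varphi)$ of every Hecke character $\varphi$ of $K$ of infinity type $[-1/2;1,0]$.
   Context: Fix the embedding $K\subset\mathbb C$ with $\sqrt{D_K}$ in the upper half plane $\mathcal H$, $D_K<0$ the discriminant of $K$. A Hecke character $\varphi$ of $K$ of infinity type $[-1/2;1,0]$ with conductor $\mathfrak c_f$ is (in ideal language) a homomorphism from fractional ideals of $\mathcal O_K$ prime to $\mathfrak c_f$ to $\mathbb C^\times$ such that for some character $\chi'_\varphi$ of $(\mathcal O_K/\mathfrak c_f)^\times$, $\varphi(\alpha\mathcal O_K)=\alpha\chi'_\varphi(\alpha)$ for all $\alpha\in\mathcal O_K$ prime to $\mathfrak c_f$, with $\mathfrak c_f$ minimal. Its Hecke theta function is $\vartheta(\tau;\varphi)=\sum_I\varphi(I)e^{2\pi i\tau\mathrm{Nm}(I)}$ over nonzero integral ideals $I$, with $\varphi(I)=0$ for $I$ not prime to $\mathfrak c_f$. Let $z_1,\dots,z_h\in\mathcal H$ represent the $\mathbb C$-isomorphism classes of elliptic curves $\mathbb C/(\mathbb Z+z\mathbb Z)$ with CM by $\mathcal O_K$. For $z=z_a$ let $(a_z,b_z,c_z)$ be coprime integers, $a_z>0$, with $a_zz^2+b_zz+c_z=0$. For a positive integer $f_\rho$ let $\Lambda_a$ be the lattice with basis $e_2,e_1$ and Gram matrix $f_\rho\begin{pmatrix}2a_z&b_z\\ b_z&2c_z\end{pmatrix}$, $G_{\Lambda_a}=\Lambda_a^\vee/\Lambda_a$,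 and $\Omega'_a$ the $\mathbb Q$-linear map $\Lambda_a\otimes\mathbb Q\to\mathbb C$ with $\Omega'_a(e_2)=\sqrt{2a_zf_\rho}$, $\Omega'_a(e_1)=-\sqrt{2a_zf_\rho}\,z$. For $\beta\in G_{\Lambda_a}$ let $\vartheta^{1\Omega'}_{\Lambda_a}(\tau_{ws};\beta)=\sum_{y\in\Lambda_a^\vee,\,y+\Lambda_a=\beta}\Omega'_a(y)e^{\pi i\tau_{ws}(y,y)}$ and $f_a(\tau;\beta)=\vartheta^{1\Omega'}_{\Lambda_a}(f_\rho|D_K|\tau;\beta)$. $F(\mathcal{E}ll(\mathcal O_K),f_\rho)$ is the $\mathbb C$-span of all $f_a(\tau;\beta)$, and $F(\mathcal{E}ll(\mathcal O_K))$ is the span of the union over all $f_\rho\ge1$ of the $F(\mathcal{E}ll(\mathcal O_K),f_\rho)$ (functions on $\mathcal H$). *)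

(* Defs.v *)
From mathcomp Require Import all_boot all_algebra.
From mathcomp Require Import complex.
From mathcomp Require Import all_classical all_reals all_analysis.
Set Implicit Arguments. Unset Strict Implicit. Unset Printing Implicit Defensive.
Import GRing.Theory Num.Theory numFieldNormedType.Exports.
Local Open Scope classical_set_scope.
Local Open Scope ring_scope.

Section HeckeTheta.
Variable R : realType.
Local Notation C := (R[i]).

Definition cRe (z : C) : R := @complex.Re R z.
Definition cIm (z : C) : R := @complex.Im R z.
Definition rC (x : R) : C := (x +i* 0)%C.
Definition iC : C := (0 +i* 1)%C.

Definition expC (w : C) : C :=
  rC (expR (cRe w)) * ((cos (cIm w)) +i* (sin (cIm w)))%C.

Definition limC (u : nat -> C) : C :=
  ((lim ((fun n => cRe (u n)) @ \oo)) +i* (lim ((fun n => cIm (u n)) @ \oo)))%C.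

Definition upper (tau : C) : Prop := 0 < cIm tau.

Definition squarefree_neg (d : int) : Prop :=
  d < 0 /\ forall p : nat, prime p -> ~~ (p ^ 2 %| `|d|)%N.

Definition sqrtd (d : int) : C := (0 +i* Num.sqrt (- (d%:~R : R)))%C.

Definition DK (d : int) : int := if (d %% 4)%Z == 1 then d else 4 * d.

Definition Kfield (d : int) : set C :=
  [set x | exists p q : rat, x = ratr p + ratr q * sqrtd d].

Definition alg_int (x : C) : Prop :=
  exists p : {poly int}, p \is monic /\ (map_poly (fun k : int => k%:~R) p).[x] = 0.

Definition OK (d : int) : set C := Kfield d `&` alg_int.

Definition frac_ideal (d : int) (I : set C) : Prop :=
  I `<=` Kfield d /\
  [/\ I 0, (exists x, I x /\ x != 0),
      (forall x y, I x -> I y -> I (x + y)),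
      (forall a x, OK d a -> I x -> I (a * x)) &
      (exists a, [/\ OK d a, a != 0 & forall x, I x -> OK d (a * x)])].

Definition int_ideal (d : int) (I : set C) : Prop :=
  frac_ideal d I /\ I `<=` OK d.

Definition ideal_mul (I J : set C) : set C :=
  [set z | exists s : seq (C * C),
      (forall p, p \in s -> I p.1 /\ J p.2) /\ z = \sum_(p <- s) p.1 * p.2].

Definition ideal_add (I J : set C) : set C := [set x + y | x in I & y in J].

Definition principal (d : int) (a : C) : set C := [set a * x | x in OK d].

Definition int_coprime (d : int) (c I : set C) : Prop :=
  int_ideal d I /\ ideal_add I c = OK d.

Definition frac_prime_to (d : int) (c I : set C) : Prop :=
  frac_ideal d I /\
  exists J1 J2, [/\ int_coprime d c J1, int_coprime d c J2 & ideal_mul I J2 = J1].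

Definition elt_prime_to (d : int) (c : set C) (a : C) : Prop :=
  [/\ OK d a, a != 0 & int_coprime d c (principal d a)].

Definition ideal_norm_is (d : int) (I : set C) (n : nat) : Prop :=
  exists s : seq C,
  [/\ size s = n, (forall x, x \in s -> OK d x),
      (forall i j, (i < n)%N -> (j < n)%N -> I (nth 0 s i - nth 0 s j) -> i = j) &
      (forall x, OK d x -> exists2 i, (i < n)%N & I (x - nth 0 s i))].

(* a character of (O_K/c)^x, viewed as a function on elements of O_K prime to c *)
Definition char_mod (d : int) (c : set C) (chi : C -> C) : Prop :=
  [/\ forall a b, elt_prime_to d c a -> elt_prime_to d c b -> c (a - b) -> chi a = chi b,
      forall a b, elt_prime_to d c a -> elt_prime_to d c b -> chi (a * b) = chi a * chi b &
      forall a, elt_prime_to d c a -> chi a != 0].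

Definition hecke_mod (d : int) (c : set C) (phi : set C -> C) (chi : C -> C) : Prop :=
  [/\ int_ideal d c, char_mod d c chi,
      forall I J, frac_prime_to d c I -> frac_prime_to d c J ->
        phi (ideal_mul I J) = phi I * phi J,
      forall I, frac_prime_to d c I -> phi I != 0 &
      forall a, elt_prime_to d c a -> phi (principal d a) = a * chi a].

(* phi is a Hecke character of infinity type [-1/2;1,0] with conductor cf:
   cf is a valid modulus and it is minimal (divides every valid modulus c of
   a Hecke character agreeing with phi) *)
Definition hecke_char (d : int) (cf : set C) (phi : set C -> C) : Prop :=
  (exists chi, hecke_mod d cf phi chi) /\
  forall (c : set C) (psi : set C -> C) (chi : C -> C),
    hecke_mod d c psi chi ->
    (forall I, frac_prime_to d c I -> frac_prime_to d cf I -> psi I = phi I) ->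
    c `<=` cf.

Definition hecke_coef (d : int) (cf : set C) (phi : set C -> C) (n : nat) : C :=
  \sum_(I \in [set I | frac_prime_to d cf I /\ int_ideal d I /\ ideal_norm_is d I n]) phi I.

Definition hecke_theta (d : int) (cf : set C) (phi : set C -> C) (tau : C) : C :=
  limC (fun N => \sum_(1 <= n < N.+1) hecke_coef d cf phi n *
                    expC (rC (2 * pi) * iC * tau * n%:R)).

Definition latt (z : C) : set C := [set x | exists m n : int, x = m%:~R + n%:~R * z].

Definition has_CM_OK (d : int) (z : C) : Prop :=
  [set a | forall x, latt z x -> latt z (a * x)] = OK d.

Definition iso_curves (z z' : C) : Prop :=
  exists2 a : C, a != 0 & [set a * x | x in latt z] = latt z'.

(* zs is a complete system of representatives of the C-isomorphism classes of
   elliptic curves C/(Z + zZ), z in H, with CM by O_K *)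
Definition CM_reps (d : int) (zs : seq C) : Prop :=
  [/\ forall k, (k < size zs)%N -> upper (nth 0 zs k) /\ has_CM_OK d (nth 0 zs k),
      forall k l, (k < size zs)%N -> (l < size zs)%N ->
        iso_curves (nth 0 zs k) (nth 0 zs l) -> k = l &
      forall z, upper z -> has_CM_OK d z -> exists2 k, (k < size zs)%N & iso_curves z (nth 0 zs k)].

Definition abc_of (z : C) (a b c : int) : Prop :=
  [/\ 0 < a, gcdz (gcdz a b) c = 1 & a%:~R * z ^+ 2 + b%:~R * z + c%:~R = 0].

(* Lambda_a with basis e2, e1 and Gram matrix f [[2a, b], [b, 2c]];
   y = u e2 + v e1 (u, v rational) lies in the dual lattice *)
Definition in_dual (f : nat) (a b c : int) (u v : rat) : Prop :=
  (exists k : int, f%:R * (2%:R * a%:~R * u + b%:~R * v) = k%:~R) /\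
  (exists k : int, f%:R * (b%:~R * u + 2%:R * c%:~R * v) = k%:~R).

Definition qform (f : nat) (a b c : int) (u v : rat) : rat :=
  f%:R * (2%:R * a%:~R * u ^+ 2 + 2%:R * b%:~R * u * v + 2%:R * c%:~R * v ^+ 2).

Definition Omega (f : nat) (z : C) (a : int) (u v : rat) : C :=
  rC (Num.sqrt (2 * a%:~R * f%:R)) * (ratr u - ratr v * z).

(* theta^{1 Omega'}_{Lambda_a}(tau_ws; beta), beta = (u0, v0) + Lambda_a;
   summed over y = (u0 + m) e2 + (v0 + n) e1, m, n in Z, as the limit of
   square partial sums |m|, |n| <= N (the series is absolutely convergent) *)
Definition theta_Omega (f : nat) (z : C) (a b c : int) (u0 v0 : rat) (tw : C) : C :=
  limC (fun N => \sum_(i < (2 * N).+1) \sum_(j < (2 * N).+1)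
    let u := u0 + ((i%:Z - N%:Z)%R)%:~R in
    let v := v0 + ((j%:Z - N%:Z)%R)%:~R in
    Omega f z a u v * expC (rC pi * iC * tw * ratr (qform f a b c u v))).

Definition f_a (d : int) (f : nat) (z : C) (a b c : int) (u0 v0 : rat) (tau : C) : C :=
  theta_Omega f z a b c u0 v0 (rC (f%:R * `|DK d|%:~R) * tau).

(* g lies in F(Ell(O_K)) = span of the union over f_rho >= 1 of the
   F(Ell(O_K), f_rho): g agrees on H with a finite C-linear combination of
   functions f_a(.; beta), with z_a among the chosen representatives zs *)
Definition in_F_Ell (d : int) (zs : seq C) (g : C -> C) : Prop :=
  exists (n : nat) (coef : nat -> C) (fr : nat -> nat) (idx : nat -> nat)
         (A B Cc : nat -> int) (u0 v0 : nat -> rat),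
  (forall k, (k < n)%N ->
     [/\ (1 <= fr k)%N, (idx k < size zs)%N,
         abc_of (nth 0 zs (idx k)) (A k) (B k) (Cc k) &
         in_dual (fr k) (A k) (B k) (Cc k) (u0 k) (v0 k)]) /\
  forall tau, upper tau ->
    g tau = \sum_(k < n) coef k *
              f_a d (fr k) (nth 0 zs (idx k)) (A k) (B k) (Cc k) (u0 k) (v0 k) tau.

End HeckeTheta.

(* Main.v *)
Require Import Defs.
From mathcomp Require Import all_boot all_order all_algebra.
From mathcomp Require Import complex finmap.
From mathcomp Require Import all_classical all_reals all_analysis.
From mathcomp Require Import ring lra zify.
Set Implicit Arguments. Unset Strict Implicit. Unset Printing Implicit Defensive.
Import Order.TTheory GRing.Theory Num.Theory numFieldNormedType.Exports.
Local Open Scope classical_set_scope.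
Local Open Scope ring_scope.

(** Write L_z = Z + zZ for a CM point z with a z^2 + b z + c = 0. Since
    O_K = Z + azZ, the inverse of the lattice conj(L_z) is a L_z, so the integral
    ideals whose conjugate is homothetic to L_z are exactly the
    J_p = a lambda conj(L_z), with lambda = p_1 + p_2 z a nonzero element of L_z,
    unique up to units. The norm of J_p is the value Q(p) = a |lambda|^2 of an
    integral binary form.

    If some J_{p_0} is prime to the conductor, pick x in J_{p_0} congruent to 1.
    Comparing x J_p with (lambda x / lambda_0) J_{p_0} shows that phi(J_p) is a
    constant times lambda chi(lambda x / lambda_0), a periodic function of lambda
    times lambda. Summing over ideals, the Hecke theta function becomes a
    finite combination of series, over cosets of f sqrt(D) L_z with f an integer
    in the conductor, of lambda q^{a |lambda|^2}.

    The relation f sqrt(D) (u - v z) = f (b u + 2 c v) + f (2 a u + b v) z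
    identifies such a coset with a coset of Lambda in its dual, and the series
    with a multiple of f_a(tau; beta). Absolute convergence allows passing from
    summation by norm to summation over squares. *)

(** The parameter lambda of an ideal is unique only up to units, so the sum over lambda counts each
    ideal as many times as there are units; the final coefficients carry the inverse of that number.
    The coefficient function is periodic already modulo f L_z. The smaller lattice f sqrt(D) L_z is
    used because its cosets are the ones that f_a sums over: sqrt(D) = 2az + b, and the factor
    f|D_K| in the argument of f_a is what turns the form of Lambda into 2Q. One positive integer f
    of the conductor serves as f_rho for all classes at once.

    The point lambda = 0 belongs to no ideal, and nothing is known about the coefficient function
    there. The factor lambda in the series makes this harmless, provided that every coset gets a
    nonzero representative at which its coefficient is read off. *)

Section ComplexBasics.
Variable R : realType.
Local Notation C := (R[i]).

Lemma rCE (x : R) : rC x = (x%:C)%C. Proof. by []. Qed.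

Lemma cRe_int (m : int) : cRe (m%:~R : C) = m%:~R.
Proof. by rewrite -[m%:~R in LHS](rmorph_int (real_complex R)). Qed.

Lemma cIm_int (m : int) : cIm (m%:~R : C) = 0.
Proof. by rewrite -[m%:~R](rmorph_int (real_complex R)). Qed.

Lemma rC_int (m : int) : rC (m%:~R : R) = m%:~R.
Proof. exact: (rmorph_int (real_complex R)). Qed.

Lemma rC_rat (q : rat) : rC (ratr q : R) = ratr q.
Proof. exact: (fmorph_rat (real_complex R)). Qed.

Lemma cReD (x y : C) : cRe (x + y) = cRe x + cRe y.
Proof. by case: x; case: y. Qed.

Lemma cImD (x y : C) : cIm (x + y) = cIm x + cIm y.
Proof. by case: x; case: y. Qed.

Lemma cReM (x y : C) : cRe (x * y) = cRe x * cRe y - cIm x * cIm y.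
Proof. by case: x; case: y. Qed.

Lemma cImM (x y : C) : cIm (x * y) = cRe x * cIm y + cIm x * cRe y.
Proof. by case: x; case: y. Qed.

Lemma cReJ (x : C) : cRe (x^*)%C = cRe x. Proof. by case: x. Qed.
Lemma cImJ (x : C) : cIm (x^*)%C = - cIm x. Proof. by case: x. Qed.

Lemma cImintM (m : int) (x : C) : cIm (m%:~R * x) = m%:~R * cIm x.
Proof. by rewrite cImM cRe_int cIm_int mul0r addr0. Qed.

Lemma eqC (x y : C) : cRe x = cRe y -> cIm x = cIm y -> x = y.
Proof. by case: x => a b; case: y => c e; rewrite /cRe /cIm /= => -> ->. Qed.

Lemma conjc_int (m : int) : ((m%:~R : C)^*)%C = m%:~R.
Proof. exact: (rmorph_int (@conjc R)). Qed.

Lemma conjc_rat (q : rat) : ((ratr q : C)^*)%C = ratr q.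
Proof. exact: (fmorph_rat (@conjc R)). Qed.

Lemma conjcD (x y : C) : ((x + y)^*)%C = (x^*)%C + (y^*)%C.
Proof. exact: rmorphD. Qed.

Lemma conjcM (x y : C) : ((x * y)^*)%C = (x^*)%C * (y^*)%C.
Proof. exact: rmorphM. Qed.

Lemma conjcN (x : C) : ((- x)^*)%C = - (x^*)%C.
Proof. exact: rmorphN. Qed.

Lemma conjcV (x : C) : ((x^-1)^*)%C = (x^*)%C^-1.
Proof. exact: fmorphV. Qed.

Lemma upper_free (z : C) (m n m' n' : int) : upper z ->
  m%:~R + n%:~R * z = m'%:~R + n'%:~R * z -> m = m' /\ n = n'.
Proof.
move=> zu E.
have /(congr1 (@cIm R)) := E.
rewrite !cImD !cIm_int !add0r !cImintM => /(mulIf (lt0r_neq0 zu)) /eqP.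
rewrite eqr_int => /eqP nn'; rewrite nn' in E *; split=> //.
by move/addIr: E => /eqP; rewrite eqr_int => /eqP.
Qed.

End ComplexBasics.

(** * Algebraic integers in the complex numbers and rationality arguments *)

Section Integers.
Lemma posz_mul_eq1 (x y : int) : 0 < x -> x * y = 1 -> x = 1.
Proof.
move=> x0 E; have : (x %| 1)%Z by apply/dvdzP; exists y; rewrite mulrC E.
by rewrite dvdz1; lia.
Qed.

Variable R : realType.
Local Notation C := (R[i]).

Lemma alg_int_quadratic (x : C) (s n : int) :
  x ^+ 2 - s%:~R * x + n%:~R = 0 -> alg_int x.
Proof.
move=> E; exists ('X^2 + (- s *: 'X + n%:P)); split.
  rewrite monicE lead_coefDl ?lead_coefXn // size_polyXn.
  rewrite (leq_ltn_trans (size_polyD _ _)) // gtn_max.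
  rewrite (leq_ltn_trans (size_scale_leq _ _)) ?size_polyX //=.
  by rewrite (leq_ltn_trans (size_polyC_leq1 _)).
rewrite !rmorphD /= map_polyXn map_polyZ /= map_polyX map_polyC /= !hornerE.
by rewrite -E rmorphN mulNr.
Qed.

(** The linear polynomial [L] divides [P] over the rationals. It is primitive, so by Gauss's lemma
    it divides [P] over the integers, and its leading coefficient, the denominator of [q], divides
    1. *)
Lemma alg_int_rat (q : rat) : alg_int (ratr q : C) -> exists m : int, q = m%:~R.
Proof.
move=> [P [Pmon]].
have -> : map_poly (fun k : int => k%:~R : C) P =
    map_poly (ratr : rat -> C) (map_poly intr P).
  by rewrite -map_poly_comp; apply: eq_map_poly => k /=; rewrite ratr_int.
move=> /eqP; rewrite horner_map fmorph_eq0 => /eqP Pq.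
have nzd : denq q != 0 by rewrite denq_neq0.
pose L : {poly int} := denq q *: 'X - (numq q)%:P.
have sL : size L = 2.
  rewrite size_polyDl size_scale ?size_polyX // size_polyN.
  by rewrite (leq_ltn_trans (size_polyC_leq1 _)).
have lL : lead_coef L = denq q.
  by rewrite lead_coefE sL /L !coefE /=; ring.
have LP : L %| P.
  rewrite -dvdp_rat_int.
  have -> : map_poly intr L = (denq q)%:~R *: ('X - q%:P) :> {poly rat}.
    rewrite rmorphB /= map_polyZ /= map_polyX map_polyC /= scalerBr.
    congr (_ - _); rewrite -mul_polyC -polyCM; congr (_%:P).
    by rewrite -[q in _ * q]divq_num_den mulrC divfK // intr_eq0.
  by rewrite dvdpZl ?intr_eq0 // dvdp_XsubCl; apply/rootP.
have [r Er] := dvdpP_int LP.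
have cL : zcontents L = 1.
  have zpos : 0 < zcontents L by rewrite -sgz_gt0 sgz_contents lL sgz_gt0 denq_gt0.
  have: (zcontents L %| zcontents L)%Z by [].
  rewrite dvdz_contents => /polyOverP Hc.
  have h1 := Hc 1%N; have h0 := Hc 0%N.
  have L1 : L`_1 = denq q by rewrite /L !coefE /= mulr1 subr0.
  have L0 : L`_0 = - numq q by rewrite /L !coefE /= mulr0 sub0r.
  rewrite L1 in h1; rewrite L0 in h0.
  have: (`|zcontents L| %| gcdn `|numq q| `|denq q|)%N.
    rewrite dvdn_gcd; apply/andP; split.
      by rewrite -(abszN (numq q)); exact: h0.
    exact: h1.
  have /eqP -> := coprime_num_den q; rewrite dvdn1 => /eqP.
  lia.
have zL : zprimitive L = L by rewrite [RHS]zpolyEprim cL scale1r.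
move: Pmon; rewrite Er zL monicE lead_coefM lL => /eqP dr.
have d1 : denq q = 1.
  exact: posz_mul_eq1 (denq_gt0 q) dr.
by exists (numq q); rewrite -[LHS]divq_num_den d1 divr1.
Qed.

Lemma alg_int_integral (x : C) : alg_int x <-> integralOver (intr : int -> C) x.
Proof.
split=> [[p [pm px]]|[p pm px]]; exists p => //; first by apply/rootP.
by split=> //; apply/rootP.
Qed.

Lemma alg_intD (x y : C) : alg_int x -> alg_int y -> alg_int (x + y).
Proof. by move=> /alg_int_integral hx /alg_int_integral hy; apply/alg_int_integral/integral_add. Qed.

Lemma alg_intM (x y : C) : alg_int x -> alg_int y -> alg_int (x * y).
Proof. by move=> /alg_int_integral hx /alg_int_integral hy; apply/alg_int_integral/integral_mul. Qed.

Lemma alg_intJ (x : C) : alg_int x -> alg_int (x^*)%C.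
Proof.
move=> [p [pm px]]; exists p; split=> //.
have -> : map_poly (fun k : int => k%:~R : C) p =
    map_poly (@conjc R) (map_poly intr p).
  by rewrite -map_poly_comp; apply: eq_map_poly => k /=; rewrite conjc_int.
by rewrite horner_map px rmorph0.
Qed.

(** The square of the reduced denominator of [r] divides [d]. The lemma serves in [OK_latt], with
    [r = 2 * q]. *)
Lemma squarefree_rat (d : int) (r : rat) (k : int) : squarefree_neg d ->
  r ^+ 2 * d%:~R = k%:~R -> exists m : int, r = m%:~R.
Proof.
move=> [dneg dsf] E.
have E2 : numq r ^+ 2 * d = k * denq r ^+ 2.
  apply: (@intr_inj rat); rewrite rmorphM rmorphXn [RHS]rmorphM rmorphXn /= -E.
  have dr0 : (denq r)%:~R != 0 :> rat by rewrite intr_eq0 denq_neq0.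
  by rewrite -{2}[r]divq_num_den; field.
have D1 : (`|denq r| ^ 2 %| `|d|)%N.
  have : (denq r ^+ 2 %| numq r ^+ 2 * d)%Z by rewrite E2 dvdz_mull.
  rewrite Gauss_dvdzr; last first.
    by rewrite coprimez_pexpl // coprimez_pexpr // coprimez_sym coprimezE coprime_num_den.
  by rewrite dvdzE abszX.
have [d1|dn1] := eqVneq (`|denq r|)%N 1%N.
  exists (numq r); have := denq_gt0 r => dp.
  have dr1 : denq r = 1 by lia.
  by rewrite -[LHS]divq_num_den dr1 divr1.
have gt1 : (1 < `|denq r|)%N by have := denq_gt0 r; move: dn1; lia.
have pp := pdiv_prime gt1.
have /negP[] := dsf _ pp.
by rewrite (dvdn_trans _ D1) // dvdn_exp2r // pdiv_dvd.
Qed.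

End Integers.

(** * The ring of integers as the lattice Z + Z om *)

Section RingOfIntegers.
Variable R : realType.
Local Notation C := (R[i]).
Variable d : int.
Hypothesis d_sf : squarefree_neg d.

Definition om : C := if (d %% 4)%Z == 1 then (1 + sqrtd R d) / 2 else sqrtd R d.
Definition tr_om : int := if (d %% 4)%Z == 1 then 1 else 0.
(** For [d = 4 * e + 1] the norm of [om] is [(1 - d) / 4 = - e]. *)
Definition nm_om : int := if (d %% 4)%Z == 1 then - (d %/ 4)%Z else - d.

Lemma sqrtd2 : sqrtd R d ^+ 2 = d%:~R.
Proof.
have [dneg _] := d_sf.
rewrite expr2 /sqrtd -rC_int /rC; simpc.
by rewrite -expr2 sqr_sqrtr ?opprK // oppr_ge0 lerz0 ltW.
Qed.

Lemma conj_sqrtd : ((sqrtd R d)^*)%C = - sqrtd R d.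
Proof. by rewrite /sqrtd; simpc. Qed.

Lemma om_conj : (om^*)%C = tr_om%:~R - om.
Proof.
rewrite /om /tr_om; case: ifP => _; last by rewrite conj_sqrtd sub0r.
rewrite conjcM conjcV conjcD conj_sqrtd (conjc_int R 1) (conjc_int R 2).
by field.
Qed.

Lemma om2 : om ^+ 2 = tr_om%:~R * om - nm_om%:~R.
Proof.
rewrite /om /tr_om /nm_om; case: ifP => [/eqP d1|_]; last first.
  by rewrite sqrtd2 mul0r sub0r rmorphN opprK.
have E : d = (d %/ 4)%Z * 4 + 1 by rewrite {1}(divz_eq d 4) d1.
have E2 : d%:~R = ((d %/ 4)%Z)%:~R * 4 + 1 :> C by rewrite {1}E rmorphD rmorphM.
have -> : ((1 + sqrtd R d) / 2) ^+ 2 = (1 + 2 * sqrtd R d + sqrtd R d ^+ 2) / 4 by field.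
by rewrite sqrtd2 E2 rmorphN /=; field.
Qed.

Lemma om_upper : upper om.
Proof.
have [dneg _] := d_sf.
have s0 : 0 < Num.sqrt (- (d%:~R : R)) by rewrite sqrtr_gt0 oppr_gt0 ltrz0.
rewrite /upper /om; case: ifP => _ //.
have -> : (1 + sqrtd R d) / 2 = (2^-1 +i* (Num.sqrt (- d%:~R) / 2))%C.
  apply: (@mulIf _ 2) => //; rewrite divfK //.
  rewrite mulr_natr mulr2n; apply: eqC.
    by rewrite !cReD /cRe /=; field.
  by rewrite !cImD /cIm /=; field.
by rewrite /cIm /= divr_gt0.
Qed.

Lemma disc_om : tr_om ^+ 2 - 4 * nm_om = DK d.
Proof.
rewrite /tr_om /nm_om /DK; case: ifP => [/eqP d1|_]; last by ring.
rewrite [RHS](divz_eq d 4) d1; ring.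
Qed.

Lemma om_Kfield : Kfield d om.
Proof.
rewrite /om; case: ifP => _.
  by exists 2^-1, 2^-1; rewrite !fmorphV !rmorph_nat; field.
by exists 0, 1; rewrite rmorph0 rmorph1 mul1r add0r.
Qed.

Lemma KfieldD (x y : C) : Kfield d x -> Kfield d y -> Kfield d (x + y).
Proof.
move=> [p [q ->]] [p' [q' ->]]; exists (p + p'), (q + q').
by rewrite !rmorphD /=; ring.
Qed.

Lemma KfieldM (x y : C) : Kfield d x -> Kfield d y -> Kfield d (x * y).
Proof.
move=> [p [q ->]] [p' [q' ->]].
exists (p * p' + q * q' * d%:~R), (p * q' + p' * q).
rewrite !rmorphD !rmorphM /= ratr_int -sqrtd2; ring.
Qed.

Lemma Kfield_rat (q : rat) : Kfield d (ratr q : C).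
Proof. by exists q, 0; rewrite rmorph0 mul0r addr0. Qed.

Lemma Kfield_int (m : int) : Kfield d (m%:~R : C).
Proof. by rewrite -(ratr_int C); apply: Kfield_rat. Qed.

Lemma latt_om_alg (x : C) : latt om x -> Kfield d x /\ alg_int x.
Proof.
move=> [m [n ->]]; split.
  apply: KfieldD; first exact: Kfield_int.
  by apply: KfieldM; [exact: Kfield_int|exact: om_Kfield].
apply: (@alg_int_quadratic _ _ (2 * m + n * tr_om) (m ^+ 2 + m * n * tr_om + n ^+ 2 * nm_om)).
have E := om2; rewrite !rmorphD !rmorphM /=.
have -> : forall a b c e w : C, (a + b * w) ^+ 2 - (2%:~R * a + b * c) * (a + b * w)
   + (a * a + a * b * c + b * b * e) = b ^+ 2 * (w ^+ 2 - (c * w - e)).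
  by move=> *; ring.
by rewrite E subrr mulr0.
Qed.

(** Trace and norm make [s = 2 * p] and [n] integers; then [(2 * q) ^+ 2 * d] is an integer, hence
    so is [t = 2 * q]. The congruence [s ^+ 2 = d * t ^+ 2] modulo 4 decides the parities of [s] and
    [t]. *)
Lemma OK_latt : OK d = latt om.
Proof.
apply/seteqP; split=> [x [Kx ix]|x /latt_om_alg[]//].
have [p [q xE]] := Kx.
have jx : (x^*)%C = ratr p - ratr q * sqrtd R d.
  by rewrite xE conjcD (conjcM (ratr q)) conj_sqrtd !conjc_rat mulrN.
have [s sE] : exists s : int, 2 * p = s%:~R.
  apply: (@alg_int_rat R); have := alg_intD ix (alg_intJ ix).
  by rewrite jx xE rmorphM /= rmorph_nat; congr alg_int; ring.
have [n nE] : exists n : int, p ^+ 2 - d%:~R * q ^+ 2 = n%:~R.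
  apply: (@alg_int_rat R); have := alg_intM ix (alg_intJ ix).
  rewrite jx xE rmorphB rmorphM /= !rmorphXn /= ratr_int -sqrtd2.
  by congr alg_int; ring.
have [t tE] : exists t : int, 2 * q = t%:~R.
  apply: (@squarefree_rat d _ (s ^+ 2 - 4 * n)) => //.
  by rewrite rmorphB rmorphXn rmorphM /= -sE -nE; ring.
have st : s ^+ 2 - d * t ^+ 2 = 4 * n.
  apply: (@intr_inj rat).
  by rewrite rmorphB rmorphXn rmorphM [RHS]rmorphM rmorphXn /= -sE -nE -tE; ring.
have [dneg dsf] := d_sf.
have d4 : ~~ (4 %| d)%Z.
  by have := dsf 2%N isT; rewrite dvdzE.
have pE : p = s%:~R / 2 by rewrite -sE mulrC mulKf.
have qE : q = t%:~R / 2 by rewrite -tE mulrC mulKf.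
have halfE (k : int) : ratr (k%:~R / 2) = k%:~R / 2 :> C.
  by rewrite fmorph_div /= ratr_int rmorph_nat.
rewrite xE pE qE !halfE.
pose s2 := (s %/ 2)%Z; pose t2 := (t %/ 2)%Z.
have := divz_eq s 2; have := divz_eq t 2.
have := @modz_ge0 s 2 isT; have := @ltz_pmod s 2 isT.
have := @modz_ge0 t 2 isT; have := @ltz_pmod t 2 isT.
rewrite -/s2 -/t2.
set a := (s %% 2)%Z; set b := (t %% 2)%Z => b2 b0 a2 a0 tE2 sE2.
have := divz_eq d 4.
have := @modz_ge0 d 4 isT; have := @ltz_pmod d 4 isT.
rewrite /om; set e := (d %/ 4)%Z; set r := (d %% 4)%Z => r4 r0 dE.
have r_n0 : r != 0 by apply: contra d4 => /eqP r00; rewrite dE r00 addr0 dvdz_mull.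
(* The congruence modulo 4, expressed by the residues [a], [b] of [s], [t] modulo 2 and [r] of [d]
   modulo 4. The explicit quotient lets [lia] test the few remaining cases. *)
have Epar : 4 * (n - s2 ^+ 2 - s2 * a + d * t2 ^+ 2 + d * t2 * b + e * b ^+ 2) = a ^+ 2 - r * b ^+ 2.
  have -> : 4 * (n - s2 ^+ 2 - s2 * a + d * t2 ^+ 2 + d * t2 * b + e * b ^+ 2) =
   4 * n + 4 * (- s2 ^+ 2 - s2 * a + d * t2 ^+ 2 + d * t2 * b + e * b ^+ 2) by ring.
  rewrite -st sE2 tE2.
  have -> : forall D, (s2 * 2 + a) ^+ 2 - D * (t2 * 2 + b) ^+ 2 +
    4 * (- s2 ^+ 2 - s2 * a + D * t2 ^+ 2 + D * t2 * b + e * b ^+ 2) =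
    a ^+ 2 - (D - e * 4) * b ^+ 2 by move=> D; ring.
  have -> : d - e * 4 = r by rewrite {1}dE; ring.
  by [].
move: Epar; set K4 := (n - _ - _ + _ + _ + _) => Epar.
case: ifP => [/eqP r1|/eqP rn1].
  have ab : a = b.
    move: Epar; rewrite r1 mul1r => Epar.
    have [a01|a01] : a = 0 \/ a = 1 by lia.
      have [b01|b01] : b = 0 \/ b = 1 by lia.
        by rewrite a01 b01.
      by move: Epar; rewrite a01 b01; lia.
    have [b01|b01] : b = 0 \/ b = 1 by lia.
      by move: Epar; rewrite a01 b01; lia.
    by rewrite a01 b01.
  (* Half of [s + t * sqrtd d] is [(s - t) / 2 + t * om], and [a = b] gives
     [s - t = 2 * (s2 - t2)]. *)
  exists (s2 - t2), t.
  rewrite sE2 tE2 ab rmorphB !rmorphD !rmorphM /=.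
  by field.
have a01 : a = 0 /\ b = 0.
  have [b01|b01] : b = 0 \/ b = 1 by lia.
    split=> //; have [a01|a01] : a = 0 \/ a = 1 by lia.
      by [].
    by move: Epar; rewrite a01 b01; lia.
  have [a01|a01] : a = 0 \/ a = 1 by lia.
    by move: Epar; rewrite a01 b01; lia.
  by move: Epar; rewrite a01 b01; lia.
exists s2, t2; rewrite sE2 tE2 a01.1 a01.2 !addr0 !rmorphM /=.
by field.
Qed.

End RingOfIntegers.

(** * Lattices Z + zZ in integer coordinates *)

Section Lattices.
Variable R : realType.
Local Notation C := (R[i]).

Definition lam (z : C) (p : int * int) : C := p.1%:~R + p.2%:~R * z.

Lemma lattP (z x : C) : latt z x <-> exists p, x = lam z p.
Proof. by split=> [[m [n ->]]|[[m n] ->]]; [exists (m, n)|exists m, n]. Qed.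

Lemma latt_lam (z : C) p : latt z (lam z p).
Proof. by apply/lattP; exists p. Qed.

Lemma lamB (z : C) p q : lam z (p - q) = lam z p - lam z q.
Proof. by rewrite /lam /= !rmorphB /=; ring. Qed.

Lemma latt_int (z : C) (m : int) : latt z m%:~R.
Proof. by exists m, 0; rewrite mul0r addr0. Qed.

Lemma latt1 (z : C) : latt z 1.
Proof. exact: (latt_int z 1). Qed.

Lemma latt_gen (z : C) : latt z z.
Proof. by exists 0, 1; rewrite mul1r add0r. Qed.

Lemma lattD (z x y : C) : latt z x -> latt z y -> latt z (x + y).
Proof.
move=> [m [n ->]] [m' [n' ->]]; exists (m + m'), (n + n').
by rewrite !rmorphD /=; ring.
Qed.

Lemma lattJ (z x : C) : latt (z^*)%C (x^*)%C <-> latt z x.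
Proof.
split=> [[m [n E]]|[m [n ->]]]; exists m, n.
  by rewrite -[LHS]conjcK E conjcD conjcM !conjc_int conjcK.
by rewrite conjcD conjcM !conjc_int.
Qed.

Lemma lam_inj (z : C) : upper z -> injective (lam z).
Proof. by move=> zu [m n] [m' n'] /(upper_free zu) /= [-> ->]. Qed.

Lemma lam_eq0 (z : C) p : upper z -> (lam z p == 0) = (p == 0).
Proof.
move=> zu; have -> : 0 = lam z 0 by rewrite /lam /= mul0r addr0.
by rewrite (inj_eq (lam_inj zu)).
Qed.

Lemma upper_neqJ (z : C) : upper z -> z - (z^*)%C != 0.
Proof.
move=> zu; apply/eqP => /(congr1 (@cIm R)).
rewrite cImD (_ : cIm (- z^*%C) = cIm z); last by case: (z) => x y /=; rewrite opprK.
move/eqP; rewrite -mulr2n mulrn_eq0 /= => /eqP z0; move: zu.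
by rewrite /upper z0 ltxx.
Qed.

End Lattices.

(** * The primitive quadratic equation of [z]: conjugate, norm form, multiplier ring *)

Section QuadraticIrrationality.
Variable R : realType.
Local Notation C := (R[i]).
Variables (z : C) (a b c : int).
Hypotheses (zu : upper z) (Habc : abc_of z a b c).
Local Notation zb := (z^*)%C.

Lemma abc_a0 : a%:~R != 0 :> C.
Proof. by case: Habc => a0 _ _; rewrite intr_eq0 gt_eqF. Qed.

Lemma abc_eq : a%:~R * z ^+ 2 = - b%:~R * z - c%:~R.
Proof.
by case: Habc => _ _ E; apply/eqP; rewrite -subr_eq0; apply/eqP; rewrite -E; ring.
Qed.

(** The equation of [z] minus its conjugate is this identity multiplied by [z - zb], which is
    nonzero on the upper half plane. *)
Lemma abc_trace : a%:~R * zb = - b%:~R - a%:~R * z.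
Proof.
have E := abc_eq.
have := congr1 (@conjc R) E.
rewrite expr2 !conjcM !conjcD !conjcN !conjcM !conjcN !conjc_int => E'.
apply/eqP; rewrite -subr_eq0; apply/eqP.
apply: (mulfI (upper_neqJ zu)); rewrite mulr0.
have -> : (z - zb) * (a%:~R * zb - (- b%:~R - a%:~R * z)) =
  (a%:~R * z ^+ 2 + b%:~R * z) - (a%:~R * (zb * zb) + b%:~R * zb) by ring.
by rewrite E E'; ring.
Qed.

Lemma abc_norm : a%:~R * (z * zb) = c%:~R.
Proof.
rewrite mulrCA abc_trace.
have -> : z * (- b%:~R - a%:~R * z) = - b%:~R * z - a%:~R * z ^+ 2 by ring.
by rewrite abc_eq; ring.
Qed.

(** The middle sign is negative because [a * (z + zb) = - b]. *)
Definition qf (p : int * int) : int :=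
  a * p.1 ^+ 2 - b * p.1 * p.2 + c * p.2 ^+ 2.

Lemma qf_norm p : (qf p)%:~R = a%:~R * (lam z p * (lam z p)^*%C).
Proof.
rewrite /lam conjcD conjcM !conjc_int /qf.
have -> : forall m n x y e : C, e * ((m + n * x) * (m + n * y)) =
   e * m * m + m * n * (e * x + e * y) + n * n * (e * (x * y)) by move=> *; ring.
rewrite abc_norm abc_trace rmorphD rmorphB !rmorphM /=; ring.
Qed.

(** A multiplier is [x = m + n * z]. That [x * z] stays in the lattice forces [a] to divide [n * b]
    and [n * c], hence [n], as the coefficients are coprime. *)
Lemma mult_ring_latt :
  [set x | forall y, latt z y -> latt z (x * y)] = latt (a%:~R * z).
Proof.
have E := abc_eq.
apply/seteqP; split=> [x /= Hx|x /= [m [n ->]] y [k [l ->]]].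
  have := Hx _ (latt1 z); rewrite mulr1 => -[m [n xE]].
  have [m' [n' xzE]] := Hx _ (latt_gen z).
  have := congr1 ( *%R a%:~R) xzE; rewrite xE.
  have -> : forall e M N : C, e * ((M + N * z) * z) = e * M * z + N * (e * z ^+ 2).
    by move=> *; ring.
  rewrite E => E2.
  have [E3 E4] : - (n * c) = a * m' /\ a * m - n * b = a * n'.
    apply: (@upper_free _ z) => //.
    transitivity (a%:~R * m%:~R * z + n%:~R * (- b%:~R * z - c%:~R) : C).
      by rewrite rmorphB rmorphN !rmorphM /=; ring.
    by rewrite E2 !rmorphM /=; ring.
  have [[u [v Euv]] [u' [v' Euv']]] := (Bezoutz a b, Bezoutz (gcdz a b) c).
  case: Habc => a0 g1 _; rewrite g1 -Euv in Euv'.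
  (* The quotient [n / a], obtained by multiplying the Bezout relation for [a], [b], [c] by [n]. *)
  pose q := n * u' * u + u' * v * (m - n') - v' * m'.
  have nE : n = q * a.
    rewrite -[LHS]mulr1 -Euv' /q.
    have -> : n * (u' * (u * a + v * b) + v' * c) =
      n * u' * u * a + u' * v * (n * b) + v' * (n * c) by ring.
    have -> : n * b = a * m - a * n' by rewrite -E4; ring.
    have -> : n * c = - (a * m') by rewrite -E3; ring.
    ring.
  exists m, q; rewrite nE rmorphM /=; ring.
exists (m * k - n * l * c), (m * l + n * k * a - n * l * b).
have -> : forall e M N K L : C, (M + N * (e * z)) * (K + L * z) =
  M * K + M * L * z + N * K * e * z + N * L * (e * z ^+ 2) by move=> *; ring.
by rewrite E rmorphB rmorphB rmorphD !rmorphM /=; ring.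
Qed.

(* The inverse of the lattice L_{conj z} is a L_z, because O_K = Z + azZ. *)
Lemma inv_latt (x : C) :
  (forall y, latt zb y -> latt (a%:~R * z) (x * y)) <->
  exists2 y, latt z y & x = a%:~R * y.
Proof.
have E := abc_eq; have T := abc_trace; have N := abc_norm.
split=> [Hx|[y [m [n ->]] ->] w [k [l ->]]].
  have := Hx _ (latt1 zb); rewrite mulr1 => -[m [n xE]].
  have [m' [n' xzE]] := Hx _ (latt_gen zb).
  have := congr1 ( *%R a%:~R) xzE; rewrite xE.
  have -> : forall e : C, e * ((m%:~R + n%:~R * (e * z)) * zb) =
    m%:~R * (e * zb) + n%:~R * e * (e * (z * zb)) by move=> *; ring.
  rewrite T N => E2.
  have [_ E4] : n * a * c - m * b = a * m' /\ - (m * a) = a * n' * a.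
    apply: (@upper_free _ z) => //.
    transitivity (m%:~R * (- b%:~R - a%:~R * z) + n%:~R * a%:~R * c%:~R : C).
      by rewrite rmorphB rmorphN !rmorphM /=; ring.
    by rewrite E2 !rmorphM /=; ring.
  have a0 : a != 0 by case: Habc => a0 _ _; rewrite gt_eqF.
  have mE : m = - (a * n').
    by apply: (mulIf a0); rewrite mulNr -E4 opprK.
  exists ((- n')%:~R + n%:~R * z); first by exists (- n'), n.
  by rewrite mE !rmorphN rmorphM /=; ring.
exists (a * m * k - m * l * b + n * l * c), (n * k - m * l).
have -> : a%:~R * (m%:~R + n%:~R * z) * (k%:~R + l%:~R * zb) =
  a%:~R * m%:~R * k%:~R + m%:~R * l%:~R * (a%:~R * zb)
  + n%:~R * k%:~R * (a%:~R * z) + n%:~R * l%:~R * (a%:~R * (z * zb)) by ring.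
by rewrite T N rmorphD !rmorphB !rmorphM /=; ring.
Qed.

End QuadraticIrrationality.

(** * Points with complex multiplication by the full ring of integers *)

Section CMPoints.
Variable R : realType.
Local Notation C := (R[i]).
Variable d : int.
Hypothesis d_sf : squarefree_neg d.
Local Notation om := (om R d).

(** Since [om] maps 1 into the lattice, [om = m + n * z], with [n] nonzero because [om] is not real.
    Substituting in the equation of [om] gives one for [z], which is then divided by its content. *)
Lemma CM_abc (z : C) : upper z -> has_CM_OK d z ->
  exists a b c, abc_of z a b c.
Proof.
move=> zu zCM.
have : OK d om by rewrite OK_latt //; exact: latt_gen.
rewrite -zCM => /(_ _ (latt1 z)); rewrite mulr1 => -[m [n omE]].
have n0 : n != 0.
  apply: contraTneq (om_upper R d_sf) => n0.
  by rewrite omE n0 mul0r addr0 /upper cIm_int ltxx.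
pose A := n ^+ 2; pose B := 2 * m * n - tr_om d * n.
pose D := m ^+ 2 - tr_om d * m + nm_om d.
have E : A%:~R * z ^+ 2 + B%:~R * z + D%:~R = 0 :> C.
  have := om2 R d_sf; rewrite omE => /eqP; rewrite -subr_eq0 => /eqP <-.
  rewrite /A /B /D rmorphXn rmorphB rmorphD rmorphB rmorphXn !rmorphM /=.
  ring.
pose g := gcdz (gcdz A B) D.
have A0 : 0 < A by rewrite /A exprn_even_gt0.
have [gA gB gD] : [/\ (g %| A)%Z, (g %| B)%Z & (g %| D)%Z].
  split; last exact: dvdz_gcdr.
    exact: (dvdz_trans (dvdz_gcdl _ _) (dvdz_gcdl _ _)).
  exact: (dvdz_trans (dvdz_gcdl _ _) (dvdz_gcdr _ _)).
have g0 : 0 < g.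
  have g_ge0 : 0 <= g by [].
  rewrite lt_def g_ge0 andbT; apply: contraTneq gA => ->.
  by rewrite dvd0z gt_eqF.
have /dvdzP[A' AE] := gA; have /dvdzP[B' BE] := gB; have /dvdzP[D' DE] := gD.
exists A', B', D'; split.
- by move: A0; rewrite AE pmulr_lgt0.
- have : g = gcdz (gcdz A' B') D' * g.
    rewrite {1}/g AE BE DE.
    have -> : forall x y, gcdz (x * g) (y * g) = gcdz x y * g.
      by move=> x y; rewrite -mulz_gcdl gtz0_abs.
    by rewrite -mulz_gcdl gtz0_abs.
  move/eqP; rewrite -{1}[g]mul1r => /eqP /(mulIf (lt0r_neq0 g0)) <- //.
- have gC : g%:~R != 0 :> C by rewrite intr_eq0 gt_eqF.
  apply: (mulIf gC); rewrite mul0r -E AE BE DE !rmorphM /=; ring.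
Qed.

Lemma CM_OK_latt (z : C) a b c : upper z -> has_CM_OK d z -> abc_of z a b c ->
  OK d = latt (a%:~R * z).
Proof. by move=> zu <- H; exact: mult_ring_latt H. Qed.

(** Both [a * z] and [om] complete 1 to a basis of the same lattice, so they differ by an integer up
    to sign; lying in the upper half plane fixes the sign. *)
Lemma CM_om (z : C) a b c : upper z -> has_CM_OK d z -> abc_of z a b c ->
  exists m : int, a%:~R * z = m%:~R + om.
Proof.
move=> zu zCM H.
have EL : latt om = latt (a%:~R * z).
  by rewrite -OK_latt // (CM_OK_latt zu zCM H).
have [m [n E]] : latt om (a%:~R * z) by rewrite EL; exact: latt_gen.
have [m' [n' E']] : latt (a%:~R * z) om by rewrite -EL; exact: latt_gen.
have [_ nn] : 0 = m' + n' * m /\ 1 = n' * n.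
  apply: (upper_free (om_upper R d_sf)).
  by rewrite mul1r add0r {1}E' E !rmorphD !rmorphM /=; ring.
have n0 : 0 < n.
  have := congr1 (@cIm R) E; rewrite cImD cIm_int add0r !cImintM => EI.
  have : 0 < n%:~R * cIm om.
    by rewrite -EI mulr_gt0 // ltr0z; case: H.
  by rewrite pmulr_lgt0 ?ltr0z //; exact: om_upper.
have n1 : n = 1 by apply: (posz_mul_eq1 n0 (y := n')); rewrite mulrC.
by exists m; rewrite E n1 mul1r.
Qed.

(** By [CM_om], [2 * a * z + b] equals [2 * om - tr_om d], and the squares of these are the two
    discriminants. *)
Lemma CM_disc (z : C) a b c : upper z -> has_CM_OK d z -> abc_of z a b c ->
  b ^+ 2 - 4 * a * c = DK d.
Proof.
move=> zu zCM H; have [m E] := CM_om zu zCM H.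
have T := abc_trace zu H; have Eq := abc_eq H.
have bE : b = - (2 * m + tr_om d).
  apply: (@intr_inj C).
  have : a%:~R * (z^*)%C = (m%:~R + om)^*%C by rewrite -E conjcM conjc_int.
  rewrite conjcD conjc_int om_conj // T E => T2.
  have -> : b%:~R = - (- b%:~R - (m%:~R + om)) - (m%:~R + om) :> C by ring.
  rewrite T2 rmorphN rmorphD rmorphM /=; ring.
apply: (@intr_inj C).
have -> : (b ^+ 2 - 4 * a * c)%:~R = (2 * (a%:~R * z) + b%:~R) ^+ 2 :> C.
  have -> : (2 * (a%:~R * z) + b%:~R) ^+ 2 =
    4 * a%:~R * (a%:~R * z ^+ 2) + 4 * a%:~R * b%:~R * z + b%:~R ^+ 2 :> C by ring.
  rewrite Eq rmorphB rmorphXn !rmorphM /=; ring.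
rewrite E -disc_om bE rmorphN rmorphD rmorphM [in RHS]rmorphB rmorphXn rmorphM /=.
have -> : forall M T W : C, (2 * (M + W) + - (2%:~R * M + T)) ^+ 2 =
  4 * W ^+ 2 - 4 * (T * W) + T ^+ 2 by move=> *; ring.
by rewrite om2 //; ring.
Qed.

End CMPoints.

(** * Subgroups of the integers, and covolumes of planar lattices *)

Lemma int_subgroup (S : set int) : (exists2 k, 0 < k & S k) ->
  (forall x y, S x -> S y -> S (x - y)) ->
  exists2 g, 0 < g /\ S g & forall k, S k -> exists q, k = q * g.
Proof.
move=> [k0 k0p Sk0] SB.
have S0 : S 0 by rewrite -(subrr k0); exact: SB.
have SN x : S x -> S (- x) by move=> Sx; rewrite -sub0r; exact: SB.
have SD x y : S x -> S y -> S (x + y).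
  by move=> Sx Sy; rewrite -[y]opprK; apply: SB => //; exact: SN.
have exP : exists n : nat, `[< (0 < n)%N /\ S n%:Z >].
  by exists `|k0|%N; apply/asboolP; rewrite gtz0_abs //; split=> //; lia.
have [g /asboolP[g0 Sg] gmin] := ex_minnP exP.
have Smul (n : nat) : S (n%:Z * g%:Z).
  elim: n => [|n IH]; first by rewrite mul0r.
  by rewrite -addn1 PoszD mulrDl mul1r; exact: SD.
have SmulZ (q : int) : S (q * g%:Z).
  case: q => n; first exact: Smul.
  by rewrite NegzE mulNr; apply: SN; exact: Smul.
exists g%:Z; first by split=> //; lia.
move=> k Sk; exists (k %/ g)%Z.
have Sr : S (k %% g)%Z.
  have -> : (k %% g)%Z = k - (k %/ g)%Z * g by rewrite {2}(divz_eq k g) addrC addKr.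
  exact: SB.
have gz : (g%:Z != 0) by lia.
have r0 := modz_ge0 k gz.
have rg : (k %% g)%Z < g by apply: ltz_pmod; lia.
rewrite {1}(divz_eq k g).
suff -> : (k %% g)%Z = 0 by rewrite addr0.
apply/eqP; apply: contraT => rn0.
have /gmin : `[< (0 < `|(k %% g)%Z|)%N /\ S `|(k %% g)%Z|%N%:Z >].
  by apply/asboolP; rewrite gez0_abs //; split=> //; lia.
lia.
Qed.

Section Area.
Variable R : realType.
Local Notation C := (R[i]).

(** The determinant of [x] and [y] as plane vectors, a signed covolume. It allows the norm of an
    ideal to be read off from any Z-basis. *)
Definition area (x y : C) : R := cIm (x^*%C * y).

Lemma areaE (x y : C) : area x y = cRe x * cIm y - cIm x * cRe y.
Proof. by rewrite /area cImM cReJ cImJ mulNr. Qed.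

Lemma area_lin (x y : C) (m n m' n' : int) :
  area (m%:~R * x + n%:~R * y) (m'%:~R * x + n'%:~R * y) =
  (m * n' - n * m')%:~R * area x y.
Proof.
rewrite !areaE !cReD !cImD !cReM !cImM !cRe_int !cIm_int rmorphB !rmorphM /=.
ring.
Qed.

(** The two base changes have integer determinants whose product is 1. *)
Lemma area_basis (x y x' y' : C) : area x' y' != 0 ->
  (forall u : C, (exists m n : int, u = m%:~R * x + n%:~R * y) <->
             (exists m n : int, u = m%:~R * x' + n%:~R * y')) ->
  `|area x y| = `|area x' y'|.
Proof.
move=> a0 H.
have [m [n xE]] : exists m n : int, x = m%:~R * x' + n%:~R * y'.
  by apply/H; exists 1, 0; rewrite mul1r mul0r addr0.
have [m' [n' yE]] : exists m n : int, y = m%:~R * x' + n%:~R * y'.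
  by apply/H; exists 0, 1; rewrite mul1r mul0r add0r.
have [k [l xE']] : exists m n : int, x' = m%:~R * x + n%:~R * y.
  by apply/H; exists 1, 0; rewrite mul1r mul0r addr0.
have [k' [l' yE']] : exists m n : int, y' = m%:~R * x + n%:~R * y.
  by apply/H; exists 0, 1; rewrite mul1r mul0r add0r.
have E : area x y = (m * n' - n * m')%:~R * area x' y'.
  by rewrite {1}xE {1}yE area_lin.
have E' : area x' y' = (k * l' - l * k')%:~R * area x y.
  by rewrite {1}xE' {1}yE' area_lin.
move: E E'; set D := m * n' - _; set D' := k * l' - _ => E E'.
have : (D' * D)%:~R = 1 :> R.
  by apply: (mulIf a0); rewrite mul1r rmorphM /= -mulrA -E -E'.
move/eqP; rewrite -[1]/(1%:~R) eqr_int => /eqP DD.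
have D0 : D != 0 by apply: contra_eq_neq DD => ->; rewrite mulr0.
have D1 : `|D| = 1.
  by apply: (@posz_mul_eq1 _ `|D'|); rewrite ?normr_gt0 // mulrC -normrM DD.
by rewrite E normrM -intr_norm D1 mul1r.
Qed.

End Area.

(** * Integral ideals: Z-basis, norm, multiplier ring *)

Section Ideals.
Variable R : realType.
Local Notation C := (R[i]).
Variable d : int.
Hypothesis d_sf : squarefree_neg d.
Local Notation om := (om R d).
Local Notation O := (OK (R:=R) d).

Lemma OK_int (m : int) : O m%:~R.
Proof. by rewrite OK_latt //; exact: latt_int. Qed.

Lemma OK_om : O om.
Proof. by rewrite OK_latt //; exact: latt_gen. Qed.

Lemma OKD (x y : C) : O x -> O y -> O (x + y).
Proof. by rewrite OK_latt //; exact: lattD. Qed.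

Lemma OKM (x y : C) : O x -> O y -> O (x * y).
Proof.
move=> [Kx ix] [Ky iy]; split; first exact: KfieldM.
exact: alg_intM.
Qed.

Lemma OKN (x : C) : O x -> O (- x).
Proof. by move=> Ox; rewrite -mulN1r; apply: OKM => //; exact: (OK_int (-1)). Qed.

Lemma OKB (x y : C) : O x -> O y -> O (x - y).
Proof. by move=> Ox Oy; apply: OKD => //; exact: OKN. Qed.

Lemma OKJ (x : C) : O x -> O (x^*)%C.
Proof.
rewrite OK_latt // => -[m [n ->]].
rewrite conjcD conjcM !conjc_int om_conj //.
exists (m + n * tr_om d), (- n); rewrite rmorphD rmorphN rmorphM /=; ring.
Qed.

Lemma OK_norm (x : C) : O x -> x != 0 -> exists2 n : int, 0 < n & x * (x^*)%C = n%:~R.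
Proof.
move=> Ox x0; move: (Ox); rewrite OK_latt // => -[m [n xE]].
pose N := m ^+ 2 + m * n * tr_om d + n ^+ 2 * nm_om d.
have E : x * (x^*)%C = N%:~R.
  rewrite xE conjcD conjcM !conjc_int om_conj //.
  have -> : forall M N T W : C, (M + N * W) * (M + N * (T - W)) =
    M * M + M * N * T + N * N * (T * W - W ^+ 2) by move=> *; ring.
  by rewrite om2 // /N !rmorphD !rmorphM /=; ring.
exists N => //; rewrite -(ltr0z R) -cRe_int -E.
rewrite cReM cReJ cImJ mulrN opprK.
rewrite lt_def addr_ge0 -?expr2 ?sqr_ge0 // andbT.
apply: contra x0; rewrite paddr_eq0 ?sqr_ge0 // !sqrf_eq0 => /andP[/eqP r0 /eqP i0].
by move: r0 i0; case: (x) => u v; rewrite /cRe /cIm /= => -> ->.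
Qed.

Section IntegralIdeal.
Variable I : set C.
Hypothesis HI : int_ideal d I.

Lemma ideal_sub x : I x -> O x.
Proof. by case: HI => _; exact. Qed.

Lemma idealD x y : I x -> I y -> I (x + y).
Proof. by case: HI => -[_ [_ _ H _ _]] _; exact: H. Qed.

Lemma idealM x y : O x -> I y -> I (x * y).
Proof. by case: HI => -[_ [_ _ _ H _]] _; exact: H. Qed.

Lemma idealZ (m : int) y : I y -> I (m%:~R * y).
Proof. by apply: idealM; exact: OK_int. Qed.

Lemma idealB x y : I x -> I y -> I (x - y).
Proof.
move=> Ix Iy; apply: idealD => //; rewrite -mulN1r.
exact: (idealZ (-1)).
Qed.

Lemma ideal_posint : exists2 n : int, 0 < n & I n%:~R.
Proof.
have [x [Ix x0]] : exists x, I x /\ x != 0 by case: HI => -[_ []].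
have [n n0 E] := OK_norm (ideal_sub Ix) x0; exists n => //.
rewrite -E mulrC; apply: idealM => //; apply: OKJ; exact: ideal_sub.
Qed.

(** Hermite normal form: [g] generates the integers of [I], and [n] generates the group of
    [om]-coordinates of its elements. *)
Lemma ideal_basis : exists g e n : int, [/\ 0 < g, 0 < n &
  forall x, I x <-> exists i j : int, x = i%:~R * g%:~R + j%:~R * (e%:~R + n%:~R * om)].
Proof.
have [k0 k00 Ik0] := ideal_posint.
have [g [g0 Ig] gP] : exists2 g : int, 0 < g /\ I g%:~R & forall k : int, I k%:~R -> exists q, k = q * g.
  apply: (@int_subgroup (fun k : int => I k%:~R)); first by exists k0.
  by move=> x y Ix Iy; rewrite rmorphB; exact: idealB.
have [n [n0 [e Ie]] nP] : exists2 n : int, 0 < n /\ (exists m : int, I (m%:~R + n%:~R * om)) &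
   forall k : int, (exists m : int, I (m%:~R + k%:~R * om)) -> exists q, k = q * n.
  apply: (@int_subgroup (fun k : int => exists m : int, I (m%:~R + k%:~R * om))).
    exists k0 => //; exists 0; rewrite add0r mulrC; apply: idealM => //; exact: OK_om.
  move=> x y [m Ix] [m' Iy]; exists (m - m').
  have := idealB Ix Iy; congr I; rewrite !rmorphB /=; ring.
exists g, e, n; split=> // x; split; last first.
  by move=> [i [j ->]]; apply: idealD; exact: idealZ.
move=> Ix; have := ideal_sub Ix; rewrite OK_latt // => -[p [q xE]].
have [j qE] : exists j, q = j * n by apply: nP; exists p; rewrite -xE.
have [i iE] : exists i, p - j * e = i * g.
  apply: gP; have := idealB Ix (idealZ j Ie); congr I.
  by rewrite xE qE !rmorphB !rmorphM /=; ring.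
exists i, j; rewrite xE qE.
have -> : p = i * g + j * e by rewrite -iE; ring.
by rewrite !rmorphD !rmorphM /=; ring.
Qed.

(** Pigeonhole: sending each residue of the first system to a congruent one of the second is
    injective. *)
Lemma ideal_norm_le n n' : ideal_norm_is d I n -> ideal_norm_is d I n' -> (n <= n')%N.
Proof.
move=> [s [_ sO sinj _]] [s' [_ s'O _ s'surj]].
have [->//|n_gt0] := posnP n.
have F (i : 'I_n) : exists j : 'I_n', I (s`_i - s'`_j).
  have [//|j jn Ij] := s'surj s`_i; last by exists (Ordinal jn).
  have [ii|ii] := ltnP i (size s); first by apply: sO; rewrite mem_nth.
  rewrite nth_default //; exact: (OK_int 0).
have [f fP] := choice F.
have finj : injective f.
  move=> i j fE; apply/val_inj/sinj; [exact: ltn_ord|exact: ltn_ord|].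
  have -> : s`_i - s`_j = (s`_i - s'`_(f i)) - (s`_j - s'`_(f j)) by rewrite fE; ring.
  exact: idealB.
by have := leq_card f finj; rewrite !card_ord.
Qed.

Lemma ideal_norm_unique n n' : ideal_norm_is d I n -> ideal_norm_is d I n' -> n = n'.
Proof. by move=> H H'; apply/eqP; rewrite eqn_leq !ideal_norm_le. Qed.

(** The points [i + j * om] with [0 <= i < g] and [0 <= j < n] represent the residues; Euclidean
    division by [n] lists them in one sequence. *)
Lemma ideal_norm_basis (g e n : int) : 0 < g -> 0 < n ->
  (forall x, I x <-> exists i j : int, x = i%:~R * g%:~R + j%:~R * (e%:~R + n%:~R * om)) ->
  ideal_norm_is d I `|(g * n)%R|%N.
Proof.
case: g => // g; case: n => // n g0 n0 IP.
rewrite abszM !absz_nat.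
pose u r : C := (r %/ n)%:Z%:~R + (r %% n)%:Z%:~R * om.
have n_gt0 : (0 < n)%N by lia.
exists (mkseq u (g * n)); split.
- by rewrite size_mkseq.
- move=> x /mapP[r _ ->]; rewrite OK_latt //; by exists (r %/ n)%:Z, (r %% n)%:Z.
- move=> i j iN jN; rewrite !nth_mkseq // => /IP[k [l]].
  have -> : u i - u j = ((i %/ n)%:Z - (j %/ n)%:Z)%:~R + ((i %% n)%:Z - (j %% n)%:Z)%:~R * om.
    by rewrite /u !rmorphB /=; ring.
  have -> : k%:~R * g%:Z%:~R + l%:~R * (e%:~R + n%:Z%:~R * om) =
     (k * g + l * e)%:~R + (l * n)%:~R * om by rewrite rmorphD !rmorphM /=; ring.
  move=> /(upper_free (om_upper R d_sf))[E1 E2].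
  have r1 := ltn_pmod i n_gt0; have r2 := ltn_pmod j n_gt0.
  have l0 : l = 0 by nia.
  have E3 : (i %% n)%N = (j %% n)%N by move: E2; rewrite l0; lia.
  have q1 : (i %/ n < g)%N by rewrite ltn_divLR.
  have q2 : (j %/ n < g)%N by rewrite ltn_divLR.
  have k0 : k = 0 by move: E1; rewrite l0; nia.
  have E4 : (i %/ n)%N = (j %/ n)%N by move: E1; rewrite l0 k0; lia.
  by rewrite (divn_eq i n) (divn_eq j n) E3 E4.
- move=> x; rewrite OK_latt // => -[p [q ->]].
  pose l := (q %/ n)%Z; pose b := `|(q %% n)%Z|%N.
  pose k := ((p - l * e) %/ g)%Z; pose a := `|((p - l * e) %% g)%Z|%N.
  have nz : n%:Z != 0 by lia.
  have gz : g%:Z != 0 by lia.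
  have bE : b%:Z = (q %% n)%Z by rewrite /b gez0_abs // modz_ge0.
  have aE : a%:Z = ((p - l * e) %% g)%Z by rewrite /a gez0_abs // modz_ge0.
  have bn : (b < n)%N by rewrite -ltz_nat bE ltz_pmod.
  have ag : (a < g)%N by rewrite -ltz_nat aE ltz_pmod.
  have rN : (a * n + b < g * n)%N by nia.
  exists (a * n + b)%N => //; rewrite nth_mkseq // /u divnMDl // modnMDl.
  rewrite divn_small // modn_small // addn0.
  apply/IP; exists k, l.
  have qE : q = l * n + b by rewrite bE -divz_eq.
  have pE : p = k * g + a + l * e.
    by have := divz_eq (p - l * e) g; rewrite -/k -aE => <-; ring.
  by rewrite qE pE !rmorphD !rmorphM /=; ring.
Qed.

(** Dividing the basis of [ideal_basis] by [g] gives [w]. Every algebraic integer of the field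
    multiplies [I], hence the lattice of [w], into itself; conversely a multiplier of that lattice
    is integral. *)
Lemma ideal_CM : exists2 w : C, upper w /\ has_CM_OK d w &
  exists2 g : int, 0 < g & forall x, I x <-> exists2 y, latt w y & x = g%:~R * y.
Proof.
have [g [e [n [g0 n0 IP]]]] := ideal_basis.
have gC : g%:~R != 0 :> C by rewrite intr_eq0 gt_eqF.
pose w : C := (e%:~R + n%:~R * om) / g%:~R.
have gw : g%:~R * w = e%:~R + n%:~R * om by rewrite mulrC divfK.
have wu : upper w.
  have : cIm (g%:~R * w) = n%:~R * cIm om.
    by rewrite gw cImD cIm_int add0r cImintM.
  rewrite cImintM => E.
  have : 0 < g%:~R * cIm w by rewrite E mulr_gt0 ?ltr0z //; exact: om_upper.
  by rewrite pmulr_rgt0 // ltr0z.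
have IP' x : I x <-> exists2 y, latt w y & x = g%:~R * y.
  split=> [/IP[i [j ->]]|[y [i [j ->]] ->]].
    by exists (i%:~R + j%:~R * w); [exists i, j|rewrite -gw; ring].
  by apply/IP; exists i, j; rewrite -gw; ring.
have wK : Kfield d w.
  apply: KfieldM => //.
    apply: KfieldD; first exact: Kfield_int.
    by apply: KfieldM => //; [exact: Kfield_int|exact: om_Kfield].
  by rewrite -(ratr_int C) -fmorphV; exact: Kfield_rat.
exists w; last by exists g.
split=> //; apply/seteqP; split=> [x /= Hx|x Ox y Ly].
  have := Hx _ (latt1 w); rewrite mulr1 => -[m [k xE]].
  have [m' [k' xwE]] := Hx _ (latt_gen w).
  split.
    rewrite xE; apply: KfieldD; first exact: Kfield_int.
    by apply: KfieldM => //; exact: Kfield_int.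
  (* Trace and determinant of multiplication by [x] in the basis 1, [w] (Cayley-Hamilton). *)
  apply: (@alg_int_quadratic _ _ (m + k') (m * k' - k * m')).
  have -> : x ^+ 2 - (m + k')%:~R * x + (m * k' - k * m')%:~R =
    (x - m%:~R - k%:~R * w) * (x - k'%:~R) + k%:~R * (x * w - m'%:~R - k'%:~R * w).
    by rewrite rmorphB rmorphD !rmorphM /=; ring.
  by rewrite xwE {1}xE; ring.
have /IP'[y' Ly' E] : I (x * (g%:~R * y)) by apply: idealM => //; apply/IP'; exists y.
suff -> : x * y = y' by [].
by apply: (mulfI gC); rewrite -E; ring.
Qed.

End IntegralIdeal.

(** The lattice of [- conj w] is the conjugate of that of [w]. This reflection moves the conjugate
    back into the upper half plane, where [CM_reps] can be applied. *)
Lemma CM_neg_conj (w : C) : has_CM_OK d w -> has_CM_OK d (- (w^*)%C).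
Proof.
have L x : latt (- (w^*)%C) x <-> latt w (x^*)%C.
  split=> [[m [n ->]]|[m [n E]]]; exists m, (- n).
    by rewrite conjcD conjcM conjcN conjcK !conjc_int rmorphN; ring.
  by rewrite -[LHS]conjcK E conjcD conjcM !conjc_int rmorphN; ring.
move=> H; apply/seteqP; split=> x /=.
  move=> Hx; rewrite -[x]conjcK; apply: OKJ; rewrite -H /= => y Ly.
  by rewrite -[y]conjcK -conjcM; apply/L/Hx/L; rewrite conjcK.
move=> /OKJ; rewrite -H /= => Hx y /L Ly.
by apply/L; rewrite conjcM; exact: Hx.
Qed.

End Ideals.

(** * The ideals J_p: norm, equality, and exhaustion of all integral ideals *)

Section IdealClass.
Implicit Types p q r : int * int.
Variable R : realType.
Local Notation C := (R[i]).
Variable d : int.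
Hypothesis d_sf : squarefree_neg d.
Local Notation om := (om R d).
Local Notation O := (OK (R:=R) d).

Definition is_unit (x : C) : Prop := [/\ x != 0, O x & O x^-1].

Section OneClass.
Variables (z : C) (a b c : int).
Hypotheses (zu : upper z) (zCM : has_CM_OK d z) (Habc : abc_of z a b c).
Local Notation zb := (z^*)%C.

Lemma OK_latt_conj (x : C) : (forall y, latt zb y -> latt zb (x * y)) <-> O x.
Proof.
split=> [Hx|Ox y].
  rewrite -[x]conjcK; apply: OKJ => //; rewrite -zCM /= => y /lattJ Ly.
  by apply/lattJ; rewrite conjcM conjcK; exact: Hx.
have := OKJ d_sf Ox; rewrite -zCM /= => Hx Ly.
rewrite -[_ * _]conjcK; apply/lattJ; rewrite conjcM; apply: Hx.
by apply/lattJ; rewrite conjcK.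
Qed.

Definition Jid (p : int * int) : set C :=
  [set a%:~R * lam z p * x | x in latt zb].

Lemma Jid_mem p x : latt zb x -> Jid p (a%:~R * lam z p * x).
Proof. by move=> Lx; exists x. Qed.

Lemma Jid_OK p : Jid p `<=` O.
Proof.
move=> _ [x Lx <-]; rewrite (CM_OK_latt zu zCM Habc).
suff H : exists2 y, latt z y & a%:~R * lam z p = a%:~R * y.
  exact: (proj2 (inv_latt zu Habc _) H).
by exists (lam z p) => //; exact: latt_lam.
Qed.

Lemma a_lam_neq0 p : p != 0 -> a%:~R * lam z p != 0.
Proof. by move=> p0; rewrite mulf_neq0 ?(abc_a0 Habc) // lam_eq0. Qed.

Lemma Jid_ideal p : p != 0 -> int_ideal d (Jid p).
Proof.
move=> p0; split; last exact: Jid_OK.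
split; first by move=> x /Jid_OK[].
split.
- by exists 0; [exact: (latt_int zb 0)|rewrite mulr0].
- exists (a%:~R * lam z p); split; last exact: a_lam_neq0.
  by rewrite -[X in Jid p X]mulr1; apply: Jid_mem; exact: latt1.
- by move=> _ _ [x Lx <-] [y Ly <-]; rewrite -mulrDr; apply: Jid_mem; exact: lattD.
- move=> e _ Oe [x Lx <-]; rewrite mulrCA; apply: Jid_mem.
  exact: (proj2 (OK_latt_conj e) Oe).
- exists 1; split; [exact: (OK_int R d_sf 1)|exact: oner_neq0|].
  by move=> x /Jid_OK; rewrite mul1r.
Qed.

Lemma qf_gt0 p : p != 0 -> 0 < qf a b c p.
Proof.
move=> p0; rewrite -(ltr0z R) -(cRe_int R) (qf_norm zu Habc).
rewrite cReM cRe_int cIm_int mul0r subr0 pmulr_rgt0; last by rewrite ltr0z; case: Habc.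
rewrite cReM cReJ cImJ mulrN opprK.
rewrite lt_def addr_ge0 -?expr2 ?sqr_ge0 // andbT.
have : lam z p != 0 by rewrite lam_eq0.
apply: contra; rewrite paddr_eq0 ?sqr_ge0 // !sqrf_eq0 => /andP[/eqP r0 /eqP i0].
by move: r0 i0; case: (lam z p) => u v; rewrite /cRe /cIm /= => -> ->.
Qed.

(** Two Z-bases of the ideal are compared by area. The Hermite basis gives [g * m] times [cIm om];
    the basis [a * lam z p], [a * lam z p * zb] gives, up to sign, [qf a b c p] times the imaginary
    part of [a * z], which is [cIm om] by [CM_om]. *)
Lemma Jid_norm p n : p != 0 -> ideal_norm_is d (Jid p) n <-> n%:Z = qf a b c p.
Proof.
move=> p0; have HI := Jid_ideal p0.
have [g [e [m [g0 m0 IP]]]] := ideal_basis d_sf HI.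
have := ideal_norm_basis d_sf g0 m0 IP.
have om0 := om_upper R d_sf.
have ar : area (g%:~R : C) (e%:~R + m%:~R * om) = (g * m)%:~R * cIm om.
  rewrite areaE cImD cImintM cIm_int cRe_int cIm_int rmorphM /=; ring.
have arJ : area (a%:~R * lam z p) (a%:~R * lam z p * zb) = - (qf a b c p)%:~R * cIm om.
  rewrite /area conjcM conjc_int.
  have -> : a%:~R * (lam z p)^*%C * (a%:~R * lam z p * zb) =
    (qf a b c p)%:~R * (a%:~R * zb) by rewrite (qf_norm zu Habc); ring.
  rewrite cImintM cImintM cImJ mulrN.
  have [k E] := CM_om d_sf zu zCM Habc.
  have := congr1 (@cIm R) E; rewrite cImintM cImD cIm_int add0r => ->.
  by rewrite mulNr mulrN.
have : `|area (g%:~R : C) (e%:~R + m%:~R * om)| = `|area (a%:~R * lam z p) (a%:~R * lam z p * zb)|.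
  apply: area_basis => [|u].
    rewrite arJ mulf_neq0 ?oppr_eq0 ?intr_eq0 //; first by rewrite gt_eqF ?qf_gt0.
    exact: lt0r_neq0.
  apply: (iff_trans (iff_sym (IP u))).
  split=> [[x [i [j ->]] <-]|[i [j ->]]].
    by exists i, j; ring.
  by exists (i%:~R + j%:~R * zb); [exists i, j|ring].
rewrite ar arJ mulNr normrN !normrM => /(mulIf _) H.
have {H} : `|(g * m)%:~R| = `|(qf a b c p)%:~R| :> R.
  by apply: H; rewrite normr_eq0; exact: lt0r_neq0.
rewrite -!intr_norm => /eqP; rewrite eqr_int => /eqP E nI.
have qE : `|(g * m)%R|%N%:Z = qf a b c p.
  by rewrite -[LHS]/(`|g * m|) E gtr0_norm // qf_gt0.
split=> [nI'|nE]; first by rewrite (ideal_norm_unique d_sf HI nI' nI).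
by have -> : n = `|(g * m)%R|%N by lia.
Qed.

(** An inclusion between the ideals makes the quotient of the two lambdas a multiplier of the
    conjugate lattice, hence an element of [O]; equality gives this for the inverse too. *)
Lemma Jid_unit p p' : p != 0 -> p' != 0 ->
  Jid p = Jid p' <-> exists2 e, is_unit e & lam z p' = e * lam z p.
Proof.
move=> p0 p'0.
have l0 : lam z p != 0 by rewrite lam_eq0.
have l'0 : lam z p' != 0 by rewrite lam_eq0.
have aC := abc_a0 Habc.
have aux q q' : lam z q != 0 -> Jid q' `<=` Jid q -> O (lam z q' / lam z q).
  move=> lq JJ; apply/OK_latt_conj => y Ly.
  have [x Lx E] := JJ _ (Jid_mem q' Ly).
  suff -> : lam z q' / lam z q * y = x by [].
  apply: (mulfI (mulf_neq0 aC lq)); rewrite E.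
  by field; rewrite lq.
split=> [E|[e [e0 Oe Oe'] E]].
  exists (lam z p' / lam z p); last by rewrite divfK.
  split; first by rewrite mulf_neq0 ?invr_eq0.
    by apply: aux => //; rewrite E.
  by rewrite invfM invrK mulrC; apply: aux => //; rewrite E.
apply/seteqP; split=> _ [x Lx <-].
  exists (e^-1 * x); first exact: (proj2 (OK_latt_conj _) Oe').
  by rewrite E; field.
exists (e * x); first exact: (proj2 (OK_latt_conj _) Oe).
by rewrite E; ring.
Qed.

End OneClass.

(** An equality makes the conjugates of the two lattices homothetic. Hence distinct representatives
    never yield the same ideal. *)
Lemma Jid_iso (z z' : C) a b c a' b' c' p p' :
  upper z -> abc_of z a b c -> upper z' -> abc_of z' a' b' c' ->
  p != 0 -> p' != 0 -> Jid z a p = Jid z' a' p' -> iso_curves z z'.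
Proof.
move=> zu H zu' H' p0 p'0 E.
have l0 := a_lam_neq0 zu H p0; have l'0 := a_lam_neq0 zu' H' p'0.
exists (((a%:~R * lam z p) / (a'%:~R * lam z' p'))^*)%C.
  by rewrite conjc_eq0 mulf_neq0 // invr_eq0.
apply/seteqP; split=> [_ [x Lx <-]|x Lx].
  have : Jid z a p (a%:~R * lam z p * (x^*)%C) by apply: Jid_mem; apply/lattJ.
  rewrite E => -[y Ly Ey]; apply/lattJ.
  rewrite conjcM conjcK.
  suff -> : a%:~R * lam z p / (a'%:~R * lam z' p') * (x^*)%C = y by [].
  by rewrite mulrAC -Ey mulrC mulKf.
have : Jid z' a' p' (a'%:~R * lam z' p' * (x^*)%C) by apply: Jid_mem; apply/lattJ.
rewrite -E => -[y Ly Ey]; exists (y^*)%C.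
  by apply/lattJ; rewrite conjcK.
rewrite -conjcM mulrAC Ey (mulrC (a'%:~R * lam z' p')) mulfK //.
exact: conjcK.
Qed.

(** Write [I] as [g] times the lattice of [w]. The point [- conj w] is isomorphic to some
    representative [z] through a factor [m], and conjugating back gives [I] as [g / conj m] times
    the conjugate lattice of [z]. *)
Lemma Jid_exhaust (zs : seq C) (I : set C) : CM_reps d zs -> int_ideal d I ->
  exists2 k, (k < size zs)%N & forall a b c, abc_of (nth 0 zs k) a b c ->
    exists2 p, p != 0 & I = Jid (nth 0 zs k) a p.
Proof.
move=> [Hz _ Hex] HI.
have [w [wu wCM] [g g0 IP]] := ideal_CM d_sf HI.
have wu' : upper (- (w^*)%C).
  by move: wu; rewrite /upper; case: (w) => x y; rewrite /cIm /= opprK.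
have [k kz [m m0 mE]] := Hex _ wu' (CM_neg_conj d_sf wCM).
exists k => // a b c H; have [zu zCM] := Hz _ kz.
set z := nth 0 zs k in H zu zCM mE *.
have aC := abc_a0 H.
have gC : g%:~R != 0 :> C by rewrite intr_eq0 gt_eqF.
have mJ0 : (m^*)%C != 0 by rewrite conjc_eq0.
have L x : latt w x <-> latt (z^*)%C ((m^*)%C * x).
  have Lw : latt w x <-> latt (- (w^*)%C) (x^*)%C.
    split=> [[i [j ->]]|[i [j E]]]; exists i, (- j).
      by rewrite conjcD conjcM !conjc_int rmorphN; ring.
    by rewrite -[LHS]conjcK E conjcD conjcM !conjc_int conjcN conjcK rmorphN; ring.
  rewrite Lw; split=> [Lx|].
    rewrite -[_ * x]conjcK; apply/lattJ; rewrite conjcM conjcK -mE.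
    by exists (x^*)%C.
  rewrite -[_ * x]conjcK => /lattJ; rewrite conjcM conjcK -mE => -[y Ly].
  by move/(mulfI m0) <-.
have IP2 x : I x <-> exists2 y, latt (z^*)%C y & x = g%:~R / (m^*)%C * y.
  rewrite IP; split=> [[y /L Ly ->]|[y Ly ->]].
    by exists ((m^*)%C * y) => //; field.
  by exists ((m^*)%C^-1 * y); [apply/L; rewrite mulrA mulfV // mul1r|field].
(* Integrality of [I] says that [g / conj m] carries the conjugate lattice into [O], which is the
   hypothesis of [inv_latt]. *)
have [y [i [j yE]] E] : exists2 y, latt z y & g%:~R / (m^*)%C = a%:~R * y.
  apply/(inv_latt zu H) => y Ly; rewrite -(CM_OK_latt zu zCM H).
  by apply: (ideal_sub HI); apply/IP2; exists y.
have {}E : g%:~R / (m^*)%C = a%:~R * lam z (i, j) by rewrite E yE.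
exists (i, j).
  rewrite -(lam_eq0 _ zu); have : g%:~R / (m^*)%C != 0 by rewrite mulf_neq0 ?invr_eq0.
  by apply: contraNneq => l0; rewrite E l0 mulr0.
apply/seteqP; split=> x.
  by move=> /IP2[u Lu ->]; exists u => //; rewrite -E.
by move=> [u Lu <-]; apply/IP2; exists u => //; rewrite -E.
Qed.

End IdealClass.

(** * Coprimality to the conductor and the character on one class *)

Section Coprime.
Implicit Types p q r : int * int.
Variable R : realType.
Local Notation C := (R[i]).
Variable d : int.
Hypothesis d_sf : squarefree_neg d.
Local Notation O := (OK (R:=R) d).
Variable cf : set C.
Hypothesis cfI : int_ideal d cf.

Lemma OK_ideal : int_ideal d O.
Proof.
split=> //; split; first by move=> x [].
split.
- exact: (OK_int R d_sf 0).
- by exists 1; split; [exact: (OK_int R d_sf 1)|exact: oner_neq0].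
- exact: OKD.
- exact: OKM.
- by exists 1; split=> [||x]; [exact: (OK_int R d_sf 1)|exact: oner_neq0|rewrite mul1r].
Qed.

Lemma principal_ideal (x : C) : O x -> x != 0 -> int_ideal d (principal d x).
Proof.
move=> Ox x0; have sub : principal d x `<=` O by move=> _ [y Oy <-]; exact: OKM.
split=> //; split; first by move=> y /sub[].
split.
- by exists 0; [exact: (OK_int R d_sf 0)|rewrite mulr0].
- exists x; split=> //; exists 1; [exact: (OK_int R d_sf 1)|by rewrite mulr1].
- by move=> _ _ [y Oy <-] [y' Oy' <-]; exists (y + y'); [exact: OKD|rewrite mulrDr].
- by move=> e _ Oe [y Oy <-]; exists (e * y); [exact: OKM|rewrite mulrCA].
- exists 1; split; [exact: (OK_int R d_sf 1)|exact: oner_neq0|].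
  by move=> y /sub; rewrite mul1r.
Qed.

Lemma int_coprimeP (I : set C) : int_ideal d I ->
  int_coprime d cf I <-> exists2 x, I x & cf (1 - x).
Proof.
move=> HI; split=> [[_ E]|[x Ix cx]].
  have : O 1 by exact: (OK_int R d_sf 1).
  rewrite -E => -[x Ix [y cy xy]]; exists x => //.
  by rewrite -xy addrC addKr.
split=> //; apply/seteqP; split=> [_ [y Iy [w cw <-]]|y Oy].
  by apply: OKD => //; [exact: (ideal_sub HI)|exact: (ideal_sub cfI)].
exists (y * x); first exact: (idealM HI).
by exists (y * (1 - x)); [exact: (idealM cfI)|ring].
Qed.

Lemma elt_prime_toP (x : C) : O x -> x != 0 ->
  elt_prime_to d cf x <-> exists2 y, O y & cf (1 - x * y).
Proof.
move=> Ox x0; split=> [[_ _ /int_coprimeP]|[y Oy cy]].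
  by move=> /(_ (principal_ideal Ox x0))[_ [y Oy <-] cy]; exists y.
split=> //; apply/int_coprimeP; first exact: principal_ideal.
by exists (x * y) => //; exists y.
Qed.

Lemma coprime_nonzero (I : set C) : int_ideal d I -> int_coprime d cf I ->
  exists x, [/\ I x, x != 0 & cf (1 - x)].
Proof.
move=> HI /int_coprimeP[//|x Ix cx].
have [x0|x0] := eqVneq x 0; last by exists x.
(* If [x = 0] then [cf] contains 1, so every nonzero element of [I] will do. *)
have [y [Iy y0]] : exists x, I x /\ x != 0 by case: HI => -[_ []].
exists y; split=> //.
have Oy : O (1 - y) by apply: OKB => //; [exact: (OK_int R d_sf 1)|exact: (ideal_sub HI)].
by move: (idealM cfI Oy cx); rewrite x0 subr0 mulr1.
Qed.

Lemma ideal_mul_sub (I J : set C) : int_ideal d I -> J `<=` O -> ideal_mul I J `<=` I.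
Proof.
move=> HI JO x [s [sP ->]]; elim: s sP => [|q s IH] sP.
  by rewrite big_nil; case: HI => -[_ []].
rewrite big_cons; apply: (idealD HI).
  by have [I1 J2] := sP q (mem_head _ _); rewrite mulrC; apply: (idealM HI) => //; exact: JO.
by apply: IH => r rs; apply: sP; rewrite inE rs orbT.
Qed.

(** If [I * J2 = J1] with all factors integral, then [I] contains [J1] and thus an element congruent
    to 1. *)
Lemma frac_prime_to_int (I : set C) : int_ideal d I ->
  frac_prime_to d cf I <-> int_coprime d cf I.
Proof.
move=> HI; split=> [[_ [J1 [J2 [c1 c2 E]]]]|cI].
  have [x Jx cx] : exists2 x, J1 x & cf (1 - x) by apply/int_coprimeP => //; case: c1.
  apply/int_coprimeP => //; exists x => //; rewrite -E in Jx.
  by apply: ideal_mul_sub Jx => //; case: c2 => -[].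
split; first by case: HI.
exists I, O; split=> //.
  apply/int_coprimeP; first exact: OK_ideal.
  exists 1; first exact: (OK_int R d_sf 1).
  by rewrite subrr; case: cfI => -[_ []].
apply/seteqP; split; first exact: ideal_mul_sub.
move=> x Ix; exists [:: (x, 1)]; split; last by rewrite big_seq1 /= mulr1.
by move=> q; rewrite inE => /eqP -> /=; split=> //; exact: (OK_int R d_sf 1).
Qed.

Lemma mul_principal (x : C) (I : set C) : int_ideal d I ->
  ideal_mul (principal d x) I = [set x * y | y in I].
Proof.
move=> HI; apply/seteqP; split=> [w [s [sP ->]]|_ [y Iy <-]].
  elim: s sP => [|q s IH] sP.
    by rewrite big_nil; exists 0; [case: HI => -[_ []]|rewrite mulr0].
  have [|y Iy E] := IH; first by move=> r rs; apply: sP; rewrite inE rs orbT.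
  have [[e Oe xe] J2] := sP q (mem_head _ _).
  rewrite big_cons -E -xe; exists (e * q.2 + y); last by ring.
  by apply: (idealD HI) => //; exact: (idealM HI).
exists [:: (x, y)]; split; last by rewrite big_seq1.
move=> q; rewrite inE => /eqP -> /=; split=> //.
by exists 1; [exact: (OK_int R d_sf 1)|rewrite mulr1].
Qed.

Lemma coprime_mul (x y : C) : O x -> cf (1 - x) -> cf (1 - y) -> cf (1 - x * y).
Proof.
move=> Ox cx cy; have -> : 1 - x * y = (1 - x) + x * (1 - y) by ring.
by apply: (idealD cfI) => //; exact: (idealM cfI).
Qed.

Variables (phi : set C -> C) (chi : C -> C).
Hypothesis Hphi : hecke_mod d cf phi chi.

(** Extension of [phi] by zero, so that sums may run over all points [p]; [hecke_coef] restricts its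
    index set instead. *)
Definition Phi (I : set C) : C := if `[< int_coprime d cf I >] then phi I else 0.

Lemma chi1 (x : C) : elt_prime_to d cf x -> cf (1 - x) -> chi x = 1.
Proof.
move=> ex cx; have [_ [chic chiM chi0] _ _ _] := Hphi.
have e1 : elt_prime_to d cf 1.
  apply/elt_prime_toP; [exact: (OK_int R d_sf 1)|exact: oner_neq0|].
  exists 1; first exact: (OK_int R d_sf 1).
  by rewrite mulr1 subrr; case: cfI => -[_ []].
rewrite -(chic 1 x) //; apply: (mulfI (chi0 _ e1)).
by rewrite -chiM // !mulr1.
Qed.

Section OneClass.
Variables (z : C) (a b c : int).
Hypotheses (zu : upper z) (zCM : has_CM_OK d z) (Habc : abc_of z a b c).
Local Notation J := (Jid z a).

(* With [J p0] prime to [cf] and [x] in [J p0], [x = 1 mod cf], the ideal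
   [x J_p] is [lam p x / lam p0] times [J p0]; so [phi (J p)] is read off from
   [phi] on principal ideals. *)
Lemma Phi_class (f : int) : cf f%:~R -> exists (K : C) (g : int * int -> C),
  (forall p, p != 0 -> Phi (J p) = K * (g p * lam z p)) /\
  (forall p q r, p != 0 -> q != 0 -> p - q = (f * r.1, f * r.2) -> g p = g q).
Proof.
move=> cff; have [_ [chic chiM chi0] phiM phi0 phiP] := Hphi.
have [[p0 [p00 cp0]]|none] := pselect (exists p0, p0 != 0 /\ int_coprime d cf (J p0)); last first.
  exists 0, (fun=> 0); split=> // p p0; rewrite /Phi mul0r; case: asboolP => // cp.
  by exfalso; apply: none; exists p.
have JI p := Jid_ideal d_sf zu zCM Habc (p := p).
have [x [Jx x0 cx]] := coprime_nonzero (JI _ p00) cp0.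
have l00 : lam z p0 != 0 by rewrite lam_eq0.
have Ox : O x by exact: (ideal_sub (JI _ p00)).
have [u Lu xE] := Jx.
(* This is [x / lam z p0]; thus [lam z p * y] is the element lambda x / lambda_0, and it lies in
   [J p]. *)
pose y := a%:~R * u.
have xy : lam z p0 * y = x by rewrite -xE /y; ring.
have y0 : y != 0 by apply: contraNneq x0 => y0; rewrite -xy y0 mulr0.
have Jy p : J p (lam z p * y).
  by exists u => //; rewrite /y; ring.
have Oy p : O (lam z p * y) by apply: (Jid_OK zu zCM Habc); exact: Jy.
have ex : elt_prime_to d cf x.
  apply/elt_prime_toP => //; exists 1; first exact: (OK_int R d_sf 1).
  by rewrite mulr1.
(* As [x] is 1 modulo [cf], multiplying [J p] by [x] does not affect coprimality, and neither does
   the factor [J p0] on the other side. *)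
have cJ p : p != 0 -> int_coprime d cf (J p) <-> elt_prime_to d cf (lam z p * y).
  move=> pn0; have l0 : lam z p != 0 by rewrite lam_eq0.
  have ly0 : lam z p * y != 0 by exact: mulf_neq0.
  apply: (iff_trans _ (iff_sym (elt_prime_toP (Oy p) ly0))); split.
    move=> /(int_coprimeP (JI _ pn0))[_ [v Lv <-] cv].
    exists (a%:~R * lam z p0 * v).
      by apply: (Jid_OK zu zCM Habc); exact: Jid_mem.
    have -> : lam z p * y * (a%:~R * lam z p0 * v) = x * (a%:~R * lam z p * v).
      by rewrite -xy; ring.
    exact: coprime_mul.
  move=> [w Ow cw]; apply/int_coprimeP; first exact: JI.
  exists (lam z p * y * w) => //; rewrite mulrC; apply: (idealM (JI _ pn0)) => //.
exists (phi (J p0) / lam z p0), (fun p => if `[< elt_prime_to d cf (lam z p * y) >] then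
   chi (lam z p * y) else 0); split.
  move=> p pn0; rewrite /Phi.
  have [cp|ncp] := asboolP (int_coprime d cf (J p)); last first.
    rewrite (_ : `[< elt_prime_to d cf (lam z p * y) >] = false) ?mul0r ?mulr0 //.
    by apply/asboolP => /(cJ _ pn0).
  have ep : elt_prime_to d cf (lam z p * y) by apply/cJ.
  rewrite asboolT //.
  have E : ideal_mul (principal d x) (J p) = ideal_mul (principal d (lam z p * y)) (J p0).
    rewrite !mul_principal; [|exact: JI|exact: JI].
    apply/seteqP; split=> _ [_ [v Lv <-] <-].
      exists (a%:~R * lam z p0 * v); first exact: Jid_mem.
      by rewrite -xy; ring.
    exists (a%:~R * lam z p * v); first exact: Jid_mem.
    by rewrite -xy; ring.
  have fprin w : elt_prime_to d cf w -> frac_prime_to d cf (principal d w).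
    by move=> [Ow w0 cw]; apply/frac_prime_to_int => //; exact: principal_ideal.
  have fJ q : q != 0 -> int_coprime d cf (J q) -> frac_prime_to d cf (J q).
    by move=> q0 cq; apply/frac_prime_to_int => //; exact: JI.
  have := congr1 phi E.
  rewrite phiM; [|exact: fprin|exact: fJ].
  rewrite phiM; [|exact: fprin|exact: fJ].
  rewrite !phiP // chi1 // mulr1 => E2.
  apply: (mulfI x0); rewrite E2 -xy; by field.
move=> p q r pn0 qn0 pq.
(* A shift of [p] by [f * r] changes the argument of [chi] by [f] times an element of [O], hence by
   an element of [cf]. *)
have lE : lam z p * y - lam z q * y = f%:~R * (lam z r * y).
  by rewrite -mulrBl -lamB pq /lam /= !rmorphM /=; ring.
have cpq : cf (lam z p * y - lam z q * y).
  by rewrite lE mulrC; apply: (idealM cfI).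
have tr p1 p2 : p1 != 0 -> p2 != 0 -> cf (lam z p1 * y - lam z p2 * y) ->
    elt_prime_to d cf (lam z p1 * y) -> elt_prime_to d cf (lam z p2 * y).
  move=> p1n0 p2n0 c12; have n1 : lam z p1 * y != 0 by rewrite mulf_neq0 // lam_eq0.
  have n2 : lam z p2 * y != 0 by rewrite mulf_neq0 // lam_eq0.
  move=> /(elt_prime_toP (Oy p1) n1)[w Ow cw].
  apply/(elt_prime_toP (Oy p2) n2); exists w => //.
  have -> : 1 - lam z p2 * y * w = (1 - lam z p1 * y * w) + w * (lam z p1 * y - lam z p2 * y) by ring.
  by apply: (idealD cfI) => //; exact: (idealM cfI).
have cqp : cf (lam z q * y - lam z p * y).
  by rewrite -opprB -mulN1r; exact: (idealZ d_sf cfI (-1)).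
case: asboolP => ep; case: asboolP => eq //.
- exact: chic.
- by case: eq; exact: tr ep.
- by case: ep; exact: tr eq.
Qed.

End OneClass.
End Coprime.

(** * Boxes of integer points and level sets of a definite form *)

Definition zrange (N : nat) : seq int := [seq i%:Z - N%:Z | i <- iota 0 (2 * N).+1].

Definition zbox (N : nat) : seq (int * int) := [seq (x, y) | x <- zrange N, y <- zrange N].

Lemma mem_zrange N (x : int) : (x \in zrange N) = (`|x|%N <= N)%N.
Proof.
apply/mapP/idP => [[j]|xN]; first by rewrite mem_iota; lia.
by exists `|(x + N%:Z)%R|%N; rewrite ?mem_iota; lia.
Qed.

Lemma zrange_uniq N : uniq (zrange N).
Proof. by rewrite map_inj_uniq ?iota_uniq // => i j; lia. Qed.

Lemma mem_zbox N (p : int * int) : (p \in zbox N) = (`|p.1|%N <= N)%N && (`|p.2|%N <= N)%N.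
Proof.
rewrite -!mem_zrange; apply/allpairsP/andP => [[[x y] [/= ? ? ->]]//|[h1 h2]].
by exists p; rewrite -surjective_pairing.
Qed.

Lemma zbox_uniq N : uniq (zbox N).
Proof. by apply: allpairs_uniq; rewrite ?zrange_uniq // => -[x y] [x' y'] _ _. Qed.

Section Levels.
Variables (a b c : int).
Hypotheses (a_gt0 : 0 < a) (disc_lt0 : b ^+ 2 - 4 * a * c < 0).

(** Completing the square isolates the second coordinate, and minus the discriminant is at least
    1. *)
Lemma qf_bound2 (p : int * int) : `|p.2| <= 4 * a * qf a b c p.
Proof.
case: p => x y; rewrite /qf /=.
have -> : 4 * a * (a * x ^+ 2 - b * x * y + c * y ^+ 2) =
  (2 * a * x - b * y) ^+ 2 + (- (b ^+ 2 - 4 * a * c)) * y ^+ 2 by ring.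
have h1 := sqr_ge0 (2 * a * x - b * y).
have h2 : y ^+ 2 <= (- (b ^+ 2 - 4 * a * c)) * y ^+ 2.
  by rewrite ler_peMl ?sqr_ge0 //; lia.
have h3 : `|y| <= y ^+ 2 by nia.
lia.
Qed.

Lemma qf_c_gt0 : 0 < c.
Proof. by have := sqr_ge0 b; nia. Qed.

Lemma qf_bound1 (p : int * int) : `|p.1| <= 4 * c * qf a b c p.
Proof.
case: p => x y; rewrite /qf /=.
have -> : 4 * c * (a * x ^+ 2 - b * x * y + c * y ^+ 2) =
  (2 * c * y - b * x) ^+ 2 + (- (b ^+ 2 - 4 * a * c)) * x ^+ 2 by ring.
have h1 := sqr_ge0 (2 * c * y - b * x).
have h2 : x ^+ 2 <= (- (b ^+ 2 - 4 * a * c)) * x ^+ 2.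
  by rewrite ler_peMl ?sqr_ge0 //; lia.
have h3 : `|x| <= x ^+ 2 by nia.
lia.
Qed.

(** The box is large enough by [qf_bound1] and [qf_bound2], so the filter keeps every solution of
    [qf a b c p = n]. *)
Definition level (n : nat) : seq (int * int) :=
  [seq p <- zbox (4 * (`|a| + `|c|) * n)%N | qf a b c p == n%:Z].

Lemma mem_level n (p : int * int) : (p \in level n) = (qf a b c p == n%:Z).
Proof.
rewrite mem_filter andb_idr // => /eqP E; rewrite mem_zbox.
have := qf_bound1 p; have := qf_bound2 p; rewrite E.
have c_gt0 := qf_c_gt0.
have e : (4 * (`|a| + `|c|) * n)%N%:Z = 4 * a * n%:Z + 4 * c * n%:Z.
  by rewrite !PoszM PoszD !gtz0_abs //; ring.
have h1 : 0 <= 4 * a * n%:Z by rewrite !mulr_ge0 // ltW.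
have h2 : 0 <= 4 * c * n%:Z by rewrite !mulr_ge0 // ltW.
move: e h1 h2; set X := (4 * _ * n)%N; set Y := 4 * a * _; set Z := 4 * c * _.
clearbody X Y Z => e h1 h2 h3 h4; apply/andP; split; lia.
Qed.

Lemma level_uniq n : uniq (level n).
Proof. by rewrite filter_uniq // zbox_uniq. Qed.

Definition levels_upto (N : nat) : seq (int * int) :=
  flatten [seq level n | n <- index_iota 1 N.+1].

Lemma mem_levels_upto N (p : int * int) : (p \in levels_upto N) = (0 < qf a b c p) && (qf a b c p <= N%:Z).
Proof.
apply/flatten_mapP/andP => [[n]|[q0 qN]].
  by rewrite mem_index_iota mem_level // => nN /eqP ->; lia.
exists `|qf a b c p|%N; first by rewrite mem_index_iota; lia.
by rewrite mem_level //; lia.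
Qed.

Lemma levels_upto_uniq N : uniq (levels_upto N).
Proof.
elim: N => [|N IH]; first by rewrite /levels_upto /index_iota.
have -> : levels_upto N.+1 = levels_upto N ++ level N.+1.
  have E : iota 1 N.+1 = iota 1 N ++ [:: N.+1] by rewrite -(addn1 N) iotaD (addnC 1).
  by rewrite /levels_upto /index_iota !subSS !subn0 E map_cat flatten_cat /= cats0.
rewrite cat_uniq IH level_uniq andbT /=; apply/hasPn => p.
by rewrite mem_level // mem_levels_upto /=; lia.
Qed.

End Levels.

(** * Hecke coefficients as sums over lattice points, up to the number of units *)

Section Counting.
Variable R : realType.
Local Notation C := (R[i]).
Variable d : int.
Hypothesis d_sf : squarefree_neg d.
Local Notation om := (om R d).
Local Notation O := (OK (R:=R) d).
Implicit Types p q r : int * int.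

Lemma DK_lt0 : DK d < 0.
Proof. by have [d0 _] := d_sf; rewrite /DK; case: ifP => _ //; lia. Qed.

Lemma om_abc : abc_of om 1 (- tr_om d) (nm_om d).
Proof.
split=> //; first by rewrite !gcd1z.
by rewrite om2 // rmorphN /=; ring.
Qed.

(** A unit and its inverse have positive integral norms with product 1, so units lie on level 1 of
    the norm form of [om]. *)
Lemma units_finite : exists us : seq C,
  [/\ uniq us, (0 < size us)%N & forall x, (x \in us) <-> is_unit d x].
Proof.
have D0 : (- tr_om d) ^+ 2 - 4 * 1 * nm_om d < 0.
  by have := DK_lt0; rewrite -disc_om; congr (_ < 0); ring.
have mem1 x : x \in [seq x <- [seq lam om p | p <- level 1 (- tr_om d) (nm_om d) 1] | `[< is_unit d x >]]
   <-> is_unit d x.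
  rewrite mem_filter; split=> [/andP[/asboolP]//|ux].
  rewrite asboolT //=; have [x0 Ox Ox'] := ux.
  have := Ox; rewrite OK_latt // => -[m [n xE]].
  apply/mapP; exists (m, n); last by rewrite xE.
  rewrite mem_level //; apply/eqP/(@intr_inj C).
  rewrite (qf_norm (om_upper R d_sf) om_abc) mul1r -[lam om (m, n)]xE.
  have [N N0 E] := OK_norm d_sf Ox x0.
  have xi0 : x^-1 != 0 by rewrite invr_eq0.
  have [N' N'0 E'] := OK_norm d_sf Ox' xi0.
  rewrite E; congr (_%:~R); apply: (posz_mul_eq1 N0 (y := N')).
  apply: (@intr_inj C); rewrite rmorphM /= -E -E' conjcV.
  by field; rewrite conjc_eq0 x0.
exists [seq x <- [seq lam om p | p <- level 1 (- tr_om d) (nm_om d) 1] | `[< is_unit d x >]]; split=> //.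
  rewrite filter_uniq // map_inj_uniq ?level_uniq //.
  exact: lam_inj (om_upper R d_sf).
suff : 1 \in [seq x <- [seq lam om p | p <- level 1 (- tr_om d) (nm_om d) 1] | `[< is_unit d x >]].
  by case: [seq _ <- _ | _].
apply/mem1; split; first exact: oner_neq0.
  exact: (OK_int R d_sf 1).
by rewrite invr1; exact: (OK_int R d_sf 1).
Qed.

Variable zs : seq C.
Hypothesis zs_reps : CM_reps d zs.
Variables A B D : nat -> int.
Hypothesis zs_abc : forall k, (k < size zs)%N -> abc_of (nth 0 zs k) (A k) (B k) (D k).

Definition pairs (n : nat) : seq (nat * (int * int)) :=
  [seq (k, p) | k <- iota 0 (size zs), p <- level (A k) (B k) (D k) n].

Definition Jpair (q : nat * (int * int)) : set C := Jid (nth 0 zs q.1) (A q.1) q.2.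

Let zs_up k (kz : (k < size zs)%N) : upper (nth 0 zs k).
Proof. by case: zs_reps => H _ _; case: (H _ kz). Qed.

Let zs_CM k (kz : (k < size zs)%N) : has_CM_OK d (nth 0 zs k).
Proof. by case: zs_reps => H _ _; case: (H _ kz). Qed.

Lemma zs_disc k : (k < size zs)%N -> B k ^+ 2 - 4 * A k * D k < 0.
Proof.
by move=> kz; rewrite (CM_disc d_sf (zs_up kz) (zs_CM kz) (zs_abc kz)) DK_lt0.
Qed.

Lemma mem_pairs n k p : ((k, p) \in pairs n) = (k < size zs)%N && (qf (A k) (B k) (D k) p == n%:Z).
Proof.
apply/allpairsPdep/andP => [[k' [p' [+ + [-> ->]]]]|[kz E]].
  rewrite mem_iota /= => kz; rewrite mem_level //; first by case: (zs_abc kz).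
  exact: zs_disc.
exists k, p; split=> //; first by rewrite mem_iota.
rewrite mem_level //; first by case: (zs_abc kz).
exact: zs_disc.
Qed.

Lemma pairs_uniq n : uniq (pairs n).
Proof.
apply: allpairs_uniq_dep; first exact: iota_uniq.
  by move=> k _; exact: level_uniq.
by move=> [k p] [k' p'] /= _ _ [-> ->].
Qed.

Lemma qf_neq0 a b c n p : (0 < n)%N -> qf a b c p = n%:Z -> p != 0.
Proof. by move=> n0 E; apply: contra_eq_neq E => ->; rewrite /qf /=; lia. Qed.

(** Fix one pair [(k, p0)] giving [I]. By [Jid_iso] any other one has the same [k], and by
    [Jid_unit] the quotients of lambdas run exactly through the units. *)
Lemma Jpair_count n (us : seq C) (I : set C) : (0 < n)%N ->
  uniq us -> (forall x, (x \in us) <-> is_unit d x) ->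
  int_ideal d I -> ideal_norm_is d I n ->
  count (fun q : nat * (int * int) => Jpair q == I) (pairs n) = size us.
Proof.
move=> n0 us_uniq usP HI In.
have [k kz] := Jid_exhaust d_sf zs_reps HI.
move=> /(_ _ _ _ (zs_abc kz))[p0 p00 IE].
have zu := zs_up kz; have zCM := zs_CM kz; have Habc := zs_abc kz.
have q0 : qf (A k) (B k) (D k) p0 = n%:Z.
  by apply/esym/(Jid_norm d_sf zu zCM Habc) => //; rewrite -IE.
have l0 : lam (nth 0 zs k) p0 != 0 by rewrite lam_eq0.
rewrite -size_filter -(size_map (fun q : nat * (int * int) => lam (nth 0 zs k) q.2 / lam (nth 0 zs k) p0)).
have fst (q : nat * (int * int)) : q \in [seq q <- pairs n | Jpair q == I] ->
    [/\ q.1 = k, qf (A k) (B k) (D k) q.2 = n%:Z, q.2 != 0 & Jid (nth 0 zs k) (A k) q.2 = I].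
  case: q => k' p'; rewrite mem_filter mem_pairs /Jpair /= => /and3P[/eqP JE k'z /eqP qE].
  have p'0 := qf_neq0 n0 qE.
  have kk : k' = k.
    case: zs_reps => _ Hinj _; apply: Hinj => //.
    apply: (Jid_iso (zs_up k'z) (zs_abc k'z) zu Habc p'0 p00).
    by rewrite JE IE.
  by rewrite kk in qE JE; split.
apply: perm_size; apply: uniq_perm => //.
  rewrite map_inj_in_uniq ?filter_uniq ?pairs_uniq //.
  move=> [k1 p1] [k2 p2] /fst[/= -> _ _ _] /fst[/= -> _ _ _].
  by move/(mulIf (invr_neq0 l0))/(lam_inj zu) ->.
move=> x; apply/mapP/idP => [[q /fst[qk qn qn0 JE] ->]|].
  apply/usP.
  have /(Jid_unit d_sf zu zCM Habc p00 qn0)[e ue ->] : Jid (nth 0 zs k) (A k) p0 = Jid (nth 0 zs k) (A k) q.2.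
    by rewrite JE IE.
  by rewrite mulfK.
move=> /usP ux; have [x0 Ox _] := ux.
have : latt (nth 0 zs k) (x * lam (nth 0 zs k) p0).
  by move: Ox; rewrite -zCM /=; apply; exact: latt_lam.
move=> /lattP[q qE].
have qn0 : q != 0 by rewrite -(lam_eq0 _ zu) -qE mulf_neq0.
have JE : Jid (nth 0 zs k) (A k) q = I.
  by rewrite IE; apply/esym/(Jid_unit d_sf zu zCM Habc p00 qn0); exists x.
exists (k, q); last by rewrite /= -qE mulfK.
rewrite mem_filter mem_pairs kz /Jpair /= JE eqxx /=.
by apply/eqP/esym/(Jid_norm d_sf zu zCM Habc) => //; rewrite JE.
Qed.

Variables (cf : set C) (phi : set C -> C).
Hypothesis cfI : int_ideal d cf.

Lemma hecke_coefE n (us : seq C) : (0 < n)%N ->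
  uniq us -> (forall x, (x \in us) <-> is_unit d x) ->
  hecke_coef d cf phi n * (size us)%:R =
  \sum_(k < size zs) \sum_(p <- level (A k) (B k) (D k) n)
     Phi d cf phi (Jid (nth 0 zs k) (A k) p).
Proof.
move=> n0 us_uniq usP; rewrite /hecke_coef.
set X := [set I | _].
have XJ I : X I -> exists2 q : nat * (int * int), q \in pairs n & Jpair q = I.
  move=> [_ [HI In]]; have [k kz] := Jid_exhaust d_sf zs_reps HI.
  move=> /(_ _ _ _ (zs_abc kz))[p0 p00 IE].
  exists (k, p0); last by rewrite IE.
  rewrite mem_pairs kz /=; apply/eqP/esym.
  by apply/(Jid_norm d_sf (zs_up kz) (zs_CM kz) (zs_abc kz)) => //; rewrite -IE.
(* Finiteness turns the finitely supported sum of [hecke_coef] into a sum over an enumeration. *)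
have finX : finite_set X.
  apply: (@sub_finite_set _ _ (Jpair @` [set` pairs n])).
    by move=> I /XJ[q qn <-]; exists q.
  by apply: finite_image; exact: finite_seq.
rewrite fsbig_finite //=.
have XP I : I \in fset_set X -> X I by rewrite in_fset_set // inE.
(* The number of units becomes the size of the fibre of [Jpair] over [I]; exchanging the sums then
   leaves one term for each pair. *)
transitivity (\sum_(I <- fset_set X) \sum_(q <- pairs n | Jpair q == I) Phi d cf phi I).
  rewrite big_distrl /= big_seq [RHS]big_seq; apply: eq_bigr => I /XP XI.
  have [cI [HI In]] := XI.
  rewrite big_const_seq (Jpair_count n0 us_uniq usP HI In).
  rewrite /Phi asboolT; last exact/frac_prime_to_int.
  by rewrite iter_addr_0 mulr_natr.
rewrite (exchange_big_dep xpredT) //=.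
transitivity (\sum_(q <- pairs n) Phi d cf phi (Jpair q)).
  rewrite big_seq [RHS]big_seq; apply: eq_bigr => -[k p].
  rewrite mem_pairs => /andP[kz /eqP qE].
  have p0 := qf_neq0 n0 qE.
  have HI := Jid_ideal d_sf (zs_up kz) (zs_CM kz) (zs_abc kz) p0.
  have [JX|JX] := boolP (Jpair (k, p) \in fset_set X).
    rewrite (eq_bigl (pred1 (Jpair (k, p)))); last by move=> I; rewrite /= eq_sym.
    by rewrite -big_filter filter_pred1_uniq ?fset_uniq // big_seq1.
  rewrite big_seq_cond big1.
    rewrite /Phi; case: asboolP => // cJ; exfalso; move/negP: JX; apply.
    rewrite in_fset_set // inE; split; first exact/frac_prime_to_int.
    by split=> //; apply/(Jid_norm d_sf (zs_up kz) (zs_CM kz) (zs_abc kz)).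
  by move=> I /andP[IX /eqP IE]; move/negP: JX; rewrite IE.
rewrite big_allpairs_dep /= -(big_mkord xpredT (fun k => \sum_(p <- level (A k) (B k) (D k) n)
     Phi d cf phi (Jid (nth 0 zs k) (A k) p))).
by rewrite /index_iota subn0.
Qed.

End Counting.

(** * Unconditional summability of real families *)

Section UnconditionalSums.
Variables (R : realType) (T : eqType).
Implicit Types (F G : T -> R) (S : seq T).

(** Convergence along the directed set of finite subsets: the value depends on no enumeration, so it
    serves both for summation by norm and for summation over squares. *)
Definition has_sum F (l : R) : Prop := forall e : R, 0 < e ->
  exists S0, forall S, uniq S -> {subset S0 <= S} -> `|\sum_(p <- S) F p - l| < e.

Lemma sum_subset F S S' : (forall p, 0 <= F p) -> uniq S -> uniq S' ->
  {subset S <= S'} -> \sum_(p <- S) F p <= \sum_(p <- S') F p.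
Proof.
move=> F0 uS uS' SS'.
have P : perm_eq S' (S ++ [seq p <- S' | p \notin S]).
  apply: uniq_perm => //.
    rewrite cat_uniq uS filter_uniq // andbT; apply/hasPn => p.
    by rewrite mem_filter => /andP[].
  move=> p; rewrite mem_cat mem_filter.
  by have [/SS' ->|] := boolP (p \in S).
rewrite (perm_big _ P) big_cat /= lerDl.
by apply: sumr_ge0.
Qed.

Lemma has_sum_ge0 F (M : R) : (forall p, 0 <= F p) ->
  (forall S, uniq S -> \sum_(p <- S) F p <= M) -> exists l, has_sum F l.
Proof.
move=> F0 FM.
pose E : set R := [set x | exists2 S, uniq S & x = \sum_(p <- S) F p].
have E_sup : has_sup E.
  split; first by exists 0, [::] => //; rewrite big_nil.
  by exists M => _ [S uS ->]; exact: FM.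
exists (sup E) => e e0.
have [_ [S0 uS0 ->] lt0] := sup_adherent e0 E_sup.
exists S0 => S uS sub.
have h1 := sum_subset F0 uS0 uS sub.
have h2 : \sum_(p <- S) F p <= sup E by apply: ub_le_sup; [case: E_sup|exists S].
by rewrite ltr_norml; apply/andP; split; lra.
Qed.

Lemma has_sumB F G l m : has_sum F l -> has_sum G m ->
  has_sum (fun p => F p - G p) (l - m).
Proof.
move=> HF HG e e0; have e20 : 0 < e / 2 by lra.
have [[S1 H1] [S2 H2]] := (HF _ e20, HG _ e20).
exists (S1 ++ S2) => S uS sub.
have h1 : `|\sum_(p <- S) F p - l| < e / 2.
  by apply: H1 => // p pS; apply: sub; rewrite mem_cat pS.
have h2 : `|\sum_(p <- S) G p - m| < e / 2.
  by apply: H2 => // p pS; apply: sub; rewrite mem_cat pS orbT.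
rewrite sumrB.
by move: h1 h2; rewrite !ltr_norml => /andP[? ?] /andP[? ?]; apply/andP; split; lra.
Qed.

(** [F + G] and [G] are nonnegative with bounded finite sums; subtract. *)
Lemma has_sum_dominated F G (M : R) : (forall p, `|F p| <= G p) ->
  (forall S, uniq S -> \sum_(p <- S) G p <= M) -> exists l, has_sum F l.
Proof.
move=> FG GM.
have FG' p : - G p <= F p <= G p by rewrite -ler_norml.
have [l Hl] : exists l, has_sum (fun p => F p + G p) l.
  apply: (@has_sum_ge0 _ (M + M)) => [p|S uS]; first by have /andP[] := FG' p; lra.
  rewrite big_split /=; have := GM S uS.
  have : \sum_(p <- S) F p <= \sum_(p <- S) G p.
    by apply: ler_sum => p _; have /andP[] := FG' p.
  lra.
have [m Hm] : exists m, has_sum G m.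
  by apply: (@has_sum_ge0 _ M) => // p; have /andP[] := FG' p; lra.
exists (l - m); have := has_sumB Hl Hm; congr has_sum.
by apply/funext => p; ring.
Qed.

(** Only points with a nonzero term have to be reached eventually. This permits lists confined to
    one coset, and lists that omit the origin. *)
Lemma has_sum_cvg F l (s : nat -> seq T) : has_sum F l -> (forall N, uniq (s N)) ->
  (forall p, F p != 0 -> exists N0, forall N, (N0 <= N)%N -> p \in s N) ->
  (fun N => \sum_(p <- s N) F p) @ \oo --> l.
Proof.
move=> HF us Hs; apply/cvgrPdist_lt => e e0.
have [S0 HS0] := HF _ e0.
have [N0 HN0] : exists N0, forall N, (N0 <= N)%N -> forall p, p \in S0 -> F p != 0 -> p \in s N.
  elim: S0 {HS0} => [|p S0 [N1 H1]]; first by exists 0%N.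
  have [Fp|Fp] := eqVneq (F p) 0.
    exists N1 => N N1N q; rewrite inE => /orP[/eqP ->|]; first by rewrite Fp eqxx.
    exact: H1.
  have [N2 H2] := Hs _ Fp; exists (maxn N1 N2) => N; rewrite geq_max => /andP[h1 h2] q.
  by rewrite inE => /orP[/eqP -> _|]; [exact: H2|exact: H1].
exists N0 => // N /= N0N; rewrite distrC.
(* The members of [S0] that [s N] misses have zero terms; adjoining them makes the list contain
   [S0]. *)
have -> : \sum_(p <- s N) F p = \sum_(p <- s N ++ [seq p <- undup S0 | p \notin s N]) F p.
  rewrite big_cat /= [X in _ = _ + X]big_seq [X in _ = _ + X]big1 ?addr0 // => p.
  rewrite mem_filter mem_undup => /andP[pN pS]; apply/eqP; apply: contraNT pN => Fp.
  exact: HN0 pS Fp.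
apply: HS0 => [|p pS].
  rewrite cat_uniq us filter_uniq ?undup_uniq // andbT; apply/hasPn => p.
  by rewrite mem_filter => /andP[].
by rewrite mem_cat mem_filter mem_undup pS andbT orbN.
Qed.

End UnconditionalSums.

(** * Limits and unconditional sums of complex families, by real and imaginary parts *)

Section ComplexLimits.
Variable R : realType.
Local Notation C := (R[i]).

Definition cvgC (u : nat -> C) (l : C) : Prop :=
  ((fun n => cRe (u n)) @ \oo --> cRe l) /\ ((fun n => cIm (u n)) @ \oo --> cIm l).

Lemma cvgC_lim u l : cvgC u l -> limC u = l.
Proof.
move=> [h1 h2]; rewrite /limC (cvg_lim (@Rhausdorff R) h1) (cvg_lim (@Rhausdorff R) h2).
by case: (l).
Qed.

Lemma cvgC_cst l : cvgC (fun=> l) l.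
Proof. by split; exact: cvg_cst. Qed.

Lemma cvgCD u v l m : cvgC u l -> cvgC v m -> cvgC (fun n => u n + v n) (l + m).
Proof.
move=> [h1 h2] [h3 h4]; split.
  by under eq_fun do rewrite cReD; rewrite cReD; exact: cvgD.
by under eq_fun do rewrite cImD; rewrite cImD; exact: cvgD.
Qed.

Lemma cvgCM u l (k : C) : cvgC u l -> cvgC (fun n => k * u n) (k * l).
Proof.
move=> [h1 h2]; split.
  under eq_fun do rewrite cReM; rewrite cReM.
  by apply: cvgB; apply: cvgM => //; exact: cvg_cst.
under eq_fun do rewrite cImM; rewrite cImM.
by apply: cvgD; apply: cvgM => //; exact: cvg_cst.
Qed.

Lemma cvgC_sum (I : Type) (r : seq I) (u : I -> nat -> C) (l : I -> C) :
  (forall i, cvgC (u i) (l i)) ->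
  cvgC (fun n => \sum_(i <- r) u i n) (\sum_(i <- r) l i).
Proof.
move=> H; elim: r => [|x r IH].
  by under eq_fun do rewrite big_nil; rewrite big_nil; exact: cvgC_cst.
by under eq_fun do rewrite big_cons; rewrite big_cons; exact: cvgCD.
Qed.

Lemma cRe_sum (I : Type) (r : seq I) (F : I -> C) :
  cRe (\sum_(i <- r) F i) = \sum_(i <- r) cRe (F i).
Proof. by elim/big_rec2: _ => // i x y _ <-; rewrite cReD. Qed.

Lemma cIm_sum (I : Type) (r : seq I) (F : I -> C) :
  cIm (\sum_(i <- r) F i) = \sum_(i <- r) cIm (F i).
Proof. by elim/big_rec2: _ => // i x y _ <-; rewrite cImD. Qed.

Definition chas_sum (T : eqType) (F : T -> C) (l : C) : Prop :=
  has_sum (fun p => cRe (F p)) (cRe l) /\ has_sum (fun p => cIm (F p)) (cIm l).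

Lemma chas_sum_cvg (T : eqType) (F : T -> C) l (s : nat -> seq T) :
  chas_sum F l -> (forall N, uniq (s N)) ->
  (forall p, F p != 0 -> exists N0, forall N, (N0 <= N)%N -> p \in s N) ->
  cvgC (fun N => \sum_(p <- s N) F p) l.
Proof.
move=> [h1 h2] us Hs; split.
  under eq_fun do rewrite cRe_sum; apply: has_sum_cvg => // p Fp; apply: Hs.
  by apply: contraNneq Fp => ->.
under eq_fun do rewrite cIm_sum; apply: has_sum_cvg => // p Fp; apply: Hs.
by apply: contraNneq Fp => ->.
Qed.

End ComplexLimits.

(** * Geometric majorants over boxes *)

Section GeometricBound.
Variable R : realType.

(** The subtracted power makes the bound grow by exactly the two new terms [r ^+ N.+1], which
    carries the induction. *)
Lemma zrange_geom (r : R) N : 0 < r -> r < 1 ->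
  \sum_(x <- zrange N) r ^+ `|x|%N <= (2 - 2 * r ^+ N.+1) / (1 - r).
Proof.
move=> r0 r1; have r10 : 0 < 1 - r by rewrite subr_gt0.
elim: N => [|N IH].
  rewrite /zrange /= big_seq1 /= expr0 expr1.
  by rewrite ler_pdivlMr // mul1r; lra.
have P : perm_eq (zrange N.+1) [:: N.+1%:Z, - N.+1%:Z & zrange N].
  apply: uniq_perm; first exact: zrange_uniq.
    rewrite 2!cons_uniq in_cons 2!mem_zrange; apply/and3P.
    by split; [lia|lia|exact: zrange_uniq].
  by move=> x; rewrite mem_zrange 2!in_cons mem_zrange; lia.
rewrite (perm_big _ P) 2!big_cons abszN absz_nat.
have -> : (2 - 2 * r ^+ N.+2) / (1 - r) = r ^+ N.+1 + (r ^+ N.+1 + (2 - 2 * r ^+ N.+1) / (1 - r)).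
  by rewrite exprSr; field; rewrite lt0r_neq0.
by rewrite 2!lerD2l.
Qed.

Lemma box_geom (K r : R) (S : seq (int * int)) : 0 <= K -> 0 < r -> r < 1 -> uniq S ->
  \sum_(p <- S) K * (r ^+ `|p.1|%N * r ^+ `|p.2|%N) <= K * (2 / (1 - r)) ^+ 2.
Proof.
move=> K0 r0 r1 uS; have r10 : 0 < 1 - r by rewrite subr_gt0.
pose N := \max_(p <- S) maxn `|p.1|%N `|p.2|%N.
have sub : {subset S <= zbox N}.
  move=> p pS; rewrite mem_zbox -geq_max.
  by rewrite /N (big_rem p) //= leq_maxl.
apply: (le_trans (sum_subset _ uS (zbox_uniq N) sub)).
  by move=> p; rewrite !mulr_ge0 // exprn_ge0 // ltW.
rewrite -big_distrr /= ler_wpM2l // /zbox big_allpairs_dep /=.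
under eq_bigr do rewrite -big_distrr /=.
rewrite -big_distrl /= -expr2.
have h : \sum_(x <- zrange N) r ^+ `|x|%N <= 2 / (1 - r).
  apply: (le_trans (zrange_geom N r0 r1)).
  rewrite ler_pM2r ?invr_gt0 // gerBl.
  by rewrite mulr_ge0 // exprn_ge0 // ltW.
have h0 : 0 <= \sum_(x <- zrange N) r ^+ `|x|%N.
  by apply: sumr_ge0 => x _; rewrite exprn_ge0 // ltW.
by rewrite ler_pXn2r // nnegrE (le_trans h0 h).
Qed.

End GeometricBound.

(** * Absolute convergence of the theta series *)

Section ThetaTerms.
Variable R : realType.
Local Notation C := (R[i]).
Variables (z : C) (a b c : int).
Hypotheses (a_gt0 : 0 < a) (disc_lt0 : b ^+ 2 - 4 * a * c < 0).
Variable tau : C.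
Hypothesis tau_up : upper tau.

Definition eterm (p : int * int) : C :=
  lam z p * expC (rC (2 * pi) * iC R * tau * (qf a b c p)%:~R).

Lemma expC_Re (w : C) : `|cRe (expC w)| <= expR (cRe w).
Proof.
rewrite /expC cReM {1}/rC /= /cIm /= mul0r subr0 normrM ger0_norm ?expR_ge0 //.
by rewrite ler_piMr ?expR_ge0 //; rewrite ler_norml cos_geN1 cos_le1.
Qed.

Lemma expC_Im (w : C) : `|cIm (expC w)| <= expR (cRe w).
Proof.
rewrite /expC cImM {1}/rC /= /cIm /= mul0r addr0 normrM ger0_norm ?expR_ge0 //.
by rewrite ler_piMr ?expR_ge0 //; rewrite ler_norml sin_geN1 sin_le1.
Qed.

(** Half of the exponential decay absorbs the linear factor, since
    [t / 2 * s <= expR (t / 2 * s)]. *)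
Lemma lin_exp_bound (M t s : R) : 0 <= M -> 0 < t ->
  M * s * expR (- (t * s)) <= M * (2 / t) * expR (- (t / 2 * s)).
Proof.
move=> M0 t0.
rewrite -(mulrA M) -(mulrA M (2 / t)) ler_wpM2l //.
have -> : - (t * s) = - (t / 2 * s) + - (t / 2 * s) by lra.
rewrite expRD !mulrA ler_wpM2r ?expR_ge0 //.
rewrite expRN ler_pdivrMr ?expR_gt0 //.
have h : t / 2 * s <= expR (t / 2 * s).
  by apply: le_trans (expR_ge1Dx _); lra.
rewrite mulrC -ler_pdivrMr ?divr_gt0 //.
by rewrite invf_div mulrC.
Qed.

Lemma eterm_bound : exists K r : R, [/\ 0 <= K, 0 < r, r < 1 &
  forall p, `|cRe (eterm p)| <= K * (r ^+ `|p.1|%N * r ^+ `|p.2|%N) /\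
            `|cIm (eterm p)| <= K * (r ^+ `|p.1|%N * r ^+ `|p.2|%N)].
Proof.
have c_gt0 := qf_c_gt0 a_gt0 disc_lt0.
(* Adding [qf_bound1] and [qf_bound2] gives [s <= 4 * (a + c) * qf a b c p] for the [s] below, so
   the exponential is at most [expR (- (t * s))]. *)
pose del : R := (4 * (a + c))%:~R^-1.
have del0 : 0 < del by rewrite invr_gt0 ltr0z; lia.
pose t := 2 * pi * cIm tau * del.
have t0 : 0 < t by rewrite !mulr_gt0 // pi_gt0.
pose M := 1 + `|cRe z| + `|cIm z|.
have M0 : 0 <= M by rewrite !addr_ge0.
pose r := expR (- (t / 2)).
exists (M * (2 / t)), r; split.
- by rewrite mulr_ge0 // divr_ge0 // ltW.
- exact: expR_gt0.
- by rewrite expR_lt1; lra.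
move=> p; pose s := (`|p.1|%N + `|p.2|%N)%N.
have -> : r ^+ `|p.1|%N * r ^+ `|p.2|%N = expR (- (t / 2 * s%:R)).
  by rewrite -exprD /r -expRM_natl; congr expR; rewrite -/s; ring.
have sn : s%:R = `|p.1%:~R| + `|p.2%:~R| :> R.
  by rewrite natrD !natr_absz !intr_norm.
have w_le : cRe (rC (2 * pi) * iC R * tau * (qf a b c p)%:~R) <= - (t * s%:R).
  have -> : cRe (rC (2 * pi) * iC R * tau * (qf a b c p)%:~R) =
      - (2 * pi * cIm tau * (qf a b c p)%:~R).
    rewrite !(cReM, cImM) cRe_int cIm_int /rC /iC /= /cRe /cIm /=; ring.
  rewrite lerN2 /t -mulrA ler_wpM2l //; first by rewrite !mulr_ge0 // ?pi_ge0 // ltW.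
  rewrite /del mulrC ler_pdivrMr ?ltr0z; last by lia.
  rewrite sn -!intr_norm -!intrD -intrM ler_int.
  have := qf_bound1 a_gt0 disc_lt0 p; have := qf_bound2 a_gt0 disc_lt0 p.
  nia.
have e_le : expR (cRe (rC (2 * pi) * iC R * tau * (qf a b c p)%:~R)) <= expR (- (t * s%:R)).
  by rewrite ler_expR.
have lam_le : `|cRe (lam z p)| + `|cIm (lam z p)| <= M * s%:R.
  rewrite /lam cReD cImD cReM cImM !cRe_int !cIm_int !mul0r subr0 add0r addr0.
  have h1 : `|p.1%:~R + p.2%:~R * cRe z| <= `|p.1%:~R| + `|p.2%:~R| * `|cRe z|.
    by rewrite (le_trans (ler_normD _ _)) // normrM.
  rewrite normrM sn /M.
  have := normr_ge0 (p.1%:~R : R); have := normr_ge0 (p.2%:~R : R).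
  have := normr_ge0 (cRe z); have := normr_ge0 (cIm z).
  move: h1; set A1 := `|_ + _|; set A2 := `|p.1%:~R|; set A3 := `|p.2%:~R|.
  set A4 := `|cRe z|; set A5 := `|cIm z| => *; nra.
have main : (M * s%:R) * expR (- (t * s%:R)) <= M * (2 / t) * expR (- (t / 2 * s%:R)).
  exact: lin_exp_bound.
have fin (x y e : R) : `|x| <= e -> `|y| <= e -> e <= expR (- (t * s%:R)) ->
   `|cRe (lam z p)| * `|x| + `|cIm (lam z p)| * `|y| <= M * (2 / t) * expR (- (t / 2 * s%:R)).
  move=> xe ye ee; apply: le_trans main.
  apply: (@le_trans _ _ ((`|cRe (lam z p)| + `|cIm (lam z p)|) * expR (- (t * s%:R)))).
    by rewrite mulrDl lerD // ler_wpM2l // (le_trans _ ee).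
  by rewrite ler_wpM2r ?expR_ge0.
rewrite /eterm cReM cImM; split.
  apply: (le_trans (ler_normB _ _)); rewrite !normrM; apply: fin e_le.
    exact: expC_Re.
  exact: expC_Im.
apply: (le_trans (ler_normD _ _)); rewrite !normrM; apply: fin e_le.
  exact: expC_Im.
exact: expC_Re.
Qed.

Lemma eterm_sum (P : pred (int * int)) :
  exists l, chas_sum (fun p => if P p then eterm p else 0) l.
Proof.
have [K [r [K0 r0 r1 H]]] := eterm_bound.
have G0 p : 0 <= K * (r ^+ `|p.1|%N * r ^+ `|p.2|%N) by rewrite !mulr_ge0 // exprn_ge0 // ltW.
have B S := box_geom (S := S) K0 r0 r1.
have [x Hx] : exists x, has_sum (fun p => cRe (if P p then eterm p else 0)) x.
  apply: has_sum_dominated B => p; case: ifP => _; first by case: (H p).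
  by rewrite normr0.
have [y Hy] : exists y, has_sum (fun p => cIm (if P p then eterm p else 0)) y.
  apply: has_sum_dominated B => p; case: ifP => _; first by case: (H p).
  by rewrite normr0.
by exists (x +i* y)%C.
Qed.

End ThetaTerms.

(** * Cosets of the lattice f sqrt(D) L_z *)

Section Cosets.
Variables (f : nat) (a b c : int).
Hypotheses (f_gt0 : (0 < f)%N) (disc_lt0 : b ^+ 2 - 4 * a * c < 0).
Implicit Types p q : int * int.

(* In the coordinates of Z + zZ, multiplication by f sqrt(D) maps m - n z to [sub_disc (m, n)]. *)
Definition sub_disc q : int * int :=
  (f%:Z * (b * q.1 + 2 * c * q.2), f%:Z * (2 * a * q.1 + b * q.2)).

Definition eqv p q : bool := `[< exists r, p - q = sub_disc r >].

Lemma sub_discD q r : sub_disc (q + r) = sub_disc q + sub_disc r.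
Proof. by congr pair; rewrite /=; ring. Qed.

Lemma sub_discN q : sub_disc (- q) = - sub_disc q.
Proof. by congr pair; rewrite /=; ring. Qed.

Lemma sub_disc_inj : injective sub_disc.
Proof.
move=> q r E; apply/eqP; rewrite -subr_eq0; apply/eqP.
have : sub_disc (q - r) = 0 by rewrite sub_discD sub_discN E subrr.
have f0 : f%:Z != 0 by lia.
have D0 : b ^+ 2 - 4 * a * c != 0 by lia.
case: (q - r) => x y [].
move=> /eqP; rewrite mulf_eq0 (negbTE f0) /= => /eqP E1.
move=> /eqP; rewrite mulf_eq0 (negbTE f0) /= => /eqP E2.
congr pair.
  apply: (mulfI D0); rewrite mulr0.
  transitivity (b * (b * x + 2 * c * y) - 2 * c * (2 * a * x + b * y)); first by ring.
  by rewrite E1 E2 !mulr0 subrr.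
apply: (mulfI D0); rewrite mulr0.
transitivity (b * (2 * a * x + b * y) - 2 * a * (b * x + 2 * c * y)); first by ring.
by rewrite E1 E2 !mulr0 subrr.
Qed.

Lemma eqv_sym p q : eqv p q -> eqv q p.
Proof.
by move=> /asboolP[r E]; apply/asboolP; exists (- r); rewrite sub_discN -E opprB.
Qed.

Lemma eqv_trans p q r : eqv p q -> eqv q r -> eqv p r.
Proof.
move=> /asboolP[u E] /asboolP[v E']; apply/asboolP; exists (u + v).
by rewrite sub_discD -E -E' addrA subrK.
Qed.

(** f times the absolute discriminant: its multiples lie in the image of [sub_disc], so residues
    modulo it cover all cosets. *)
Definition modulus : nat := (f * `|(4 * a * c - b ^+ 2)%R|)%N.

(** Residues start at 1 instead of 0 to keep the origin out, since [Phi_class] compares coefficients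
    at nonzero points only. *)
Definition reps : seq (int * int) :=
  [seq (i%:Z, j%:Z) | i <- iota 1 modulus, j <- iota 1 modulus].

Lemma reps_uniq : uniq reps.
Proof. by apply: allpairs_uniq; rewrite ?iota_uniq // => -[x y] [x' y'] _ _ [-> ->]. Qed.

Lemma reps_neq0 p : p \in reps -> p != 0.
Proof.
move=> /allpairsP[[i j] [/= hi hj ->]]; apply/eqP => -[i0 _].
by move: hi; rewrite mem_iota i0.
Qed.

Lemma eqv_reps p : has (eqv p) reps.
Proof.
have EM : modulus%:Z = f%:Z * (4 * a * c - b ^+ 2) by rewrite PoszM gtz0_abs //; lia.
have M0 : (0 < modulus)%N by rewrite muln_gt0 f_gt0 /=; lia.
have Mz : modulus%:Z != 0 by lia.
case: p => x y.
pose i := `|(((x - 1) %% modulus)%Z + 1)%R|%N; pose j := `|(((y - 1) %% modulus)%Z + 1)%R|%N.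
have rx := modz_ge0 (x - 1) Mz; have ry := modz_ge0 (y - 1) Mz.
have lx : ((x - 1) %% modulus)%Z < modulus by apply: ltz_pmod; lia.
have ly : ((y - 1) %% modulus)%Z < modulus by apply: ltz_pmod; lia.
have iE : i%:Z = ((x - 1) %% modulus)%Z + 1 by rewrite /i; lia.
have jE : j%:Z = ((y - 1) %% modulus)%Z + 1 by rewrite /j; lia.
apply/hasP; exists (i%:Z, j%:Z).
  by apply/allpairsP; exists (i, j); split=> //=; rewrite mem_iota; lia.
pose q1 := ((x - 1) %/ modulus)%Z; pose q2 := ((y - 1) %/ modulus)%Z.
have quo (t r q M n : int) : n = r + 1 -> t - 1 = q * M + r -> t - n = M * q.
  by move=> -> E; rewrite -(subrK 1 t) E; ring.
have xE : x - i%:Z = modulus%:Z * q1 := quo _ _ _ _ _ iE (divz_eq _ _).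
have yE : y - j%:Z = modulus%:Z * q2 := quo _ _ _ _ _ jE (divz_eq _ _).
(* Minus the adjugate of the matrix [[[b, 2c], [2a, b]]] of [sub_disc], applied to [(q1, q2)]. *)
apply/asboolP; exists (- b * q1 + 2 * c * q2, 2 * a * q1 - b * q2).
transitivity (x - i%:Z, y - j%:Z); first by [].
by rewrite xE yE EM; congr pair; rewrite /=; ring.
Qed.

(** [reps] can meet a coset more than once; [rep] takes the first hit, so that [rep q == q] selects
    one point per coset. *)
Definition rep p : int * int := nth 0 reps (find (eqv p) reps).

Lemma rep_mem p : rep p \in reps.
Proof. by rewrite mem_nth // -has_find eqv_reps. Qed.

Lemma rep_eqv p : eqv p (rep p).
Proof. exact: nth_find (eqv_reps p). Qed.

Lemma eqv_rep p q : eqv p q -> rep p = rep q.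
Proof.
move=> pq; rewrite /rep; congr (nth _ _ _); apply: eq_find => r.
apply/idP/idP; first exact: eqv_trans (eqv_sym pq).
exact: eqv_trans pq.
Qed.

(** Only [q = rep p] survives, and [g] agrees there with [g p] because the image of [sub_disc]
    consists of multiples of [f]. *)
Lemma coset_expansion (A : nzRingType) (g : int * int -> A) (x : A) p :
  (forall q r, q != 0 -> p - q = (f%:Z * r.1, f%:Z * r.2) -> g p = g q) ->
  \sum_(q <- reps) (if rep q == q then g q else 0) * (if eqv p q then x else 0) =
  g p * x.
Proof.
move=> Hg; rewrite (bigD1_seq (rep p)) ?rep_mem ?reps_uniq //=.
rewrite rep_eqv -(eqv_rep (rep_eqv p)) eqxx big1 ?addr0.
  have /asboolP[r E] := rep_eqv p.
  by rewrite -(Hg _ (b * r.1 + 2 * c * r.2, 2 * a * r.1 + b * r.2)) // reps_neq0 // rep_mem.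
move=> q qp; have [pq|] := boolP (eqv p q); last by rewrite mulr0.
by rewrite -(eqv_rep pq) eq_sym (negbTE qp) mul0r.
Qed.

End Cosets.

(** * The functions f_a as theta series over cosets *)

Section ThetaOmega.
Variable R : realType.
Local Notation C := (R[i]).
Variable d : int.
Hypothesis d_sf : squarefree_neg d.
Variables (z : C) (a b c : int) (f : nat).
Hypotheses (zu : upper z) (zCM : has_CM_OK d z) (Habc : abc_of z a b c) (f_gt0 : (0 < f)%N).

(** The constant ratio of [Omega] to lambda, where lambda is [f * (2 * a * z + b)] times
    [u - v * z]. *)
Definition kappa : C := rC (Num.sqrt (2 * a%:~R * f%:R)) / (f%:R * (2 * a%:~R * z + b%:~R)).

Let a_gt0 : 0 < a. Proof. by case: Habc. Qed.

Let discE : b ^+ 2 - 4 * a * c = DK d. Proof. exact: (CM_disc d_sf zu zCM Habc). Qed.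

Let disc_lt0 : b ^+ 2 - 4 * a * c < 0. Proof. by rewrite discE; exact: DK_lt0. Qed.

Lemma sqrtD_neq0 : 2 * a%:~R * z + b%:~R != 0 :> C.
Proof.
apply/eqP => /(congr1 (@cIm R)); rewrite cImD cIm_int addr0.
have -> : 2 * a%:~R * z = (2 * a)%:~R * z by rewrite rmorphM.
by rewrite cImintM => /eqP; rewrite gt_eqF // mulr_gt0 // ltr0z mulr_gt0.
Qed.

Lemma kappa_neq0 : kappa != 0.
Proof.
have fR : f%:R != 0 :> C by rewrite pnatr_eq0 -lt0n.
rewrite mulf_neq0 ?invr_eq0 ?mulf_neq0 ?sqrtD_neq0 //.
apply/eqP => -[]/eqP; apply/negP; rewrite gt_eqF // sqrtr_gt0.
by rewrite !mulr_gt0 ?ltr0n // ltr0z.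
Qed.

(** The form of the dual vector is [2 * f * a] times the squared modulus of [u - v * z], while
    [qf a b c p] is [a] times that of lambda; hence [f] times the absolute discriminant turns the
    former into twice the latter. *)
Lemma theta_term (tau : C) (u v : rat) (p : int * int) :
  f%:R * (b%:~R * u + 2 * c%:~R * v) = p.1%:~R ->
  f%:R * (2 * a%:~R * u + b%:~R * v) = p.2%:~R ->
  Omega f z a u v *
    expC (rC pi * iC R * (rC (f%:R * `|DK d|%:~R) * tau) * ratr (qform f a b c u v)) =
  kappa * eterm z a b c tau p.
Proof.
move=> E1 E2.
have fC : f%:R != 0 :> C by rewrite pnatr_eq0 -lt0n.
have rnat (n : nat) : ratr n%:R = n%:R :> C by rewrite rmorph_nat.
have rM (x y : rat) : ratr (x * y) = ratr x * ratr y :> C by rewrite rmorphM.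
have rD (x y : rat) : ratr (x + y) = ratr x + ratr y :> C by rewrite rmorphD.
have lamE : lam z p = f%:R * (2 * a%:~R * z + b%:~R) * (ratr u - ratr v * z).
  rewrite /lam.
  have -> : p.1%:~R = f%:R * (b%:~R * ratr u + 2 * c%:~R * ratr v) :> C.
    by rewrite -[LHS]ratr_int -E1 !(rnat, ratr_int, rM, rD).
  have -> : p.2%:~R = f%:R * (2 * a%:~R * ratr u + b%:~R * ratr v) :> C.
    by rewrite -[LHS]ratr_int -E2 !(rnat, ratr_int, rM, rD).
  have -> : forall U V : C, f%:R * (2 * a%:~R * z + b%:~R) * (U - V * z) =
    f%:R * (b%:~R * U + 2 * a%:~R * U * z - b%:~R * V * z - 2 * V * (a%:~R * z ^+ 2)).
    by move=> U V; ring.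
  by rewrite (abc_eq Habc); ring.
have qE : f%:R * `|DK d|%:~R * qform f a b c u v = 2 * (qf a b c p)%:~R.
  have -> : `|DK d| = 4 * a * c - b ^+ 2.
    by rewrite -discE ltr0_norm // opprB.
  have dE : (4 * a * c - b ^+ 2)%:~R = 4 * a%:~R * c%:~R - b%:~R ^+ 2 :> rat.
    by rewrite rmorphB rmorphXn !rmorphM.
  have qfE : (qf a b c p)%:~R = a%:~R * p.1%:~R ^+ 2 - b%:~R * p.1%:~R * p.2%:~R
      + c%:~R * p.2%:~R ^+ 2 :> rat.
    by rewrite /qf rmorphD rmorphB !rmorphM /=; ring.
  by rewrite dE qfE -E1 -E2 /qform; ring.
rewrite /Omega /eterm lamE /kappa.
have -> : rC pi * iC R * (rC (f%:R * `|DK d|%:~R) * tau) * ratr (qform f a b c u v) =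
  rC (2 * pi) * iC R * tau * (qf a b c p)%:~R.
  have -> : rC (f%:R * `|DK d|%:~R : R) = ratr (f%:R * `|DK d|%:~R).
    by rewrite -rC_rat rmorphM /= rmorph_nat ratr_int.
  have -> : rC (2 * pi : R) = 2 * rC pi by rewrite !rCE rmorphM /= rmorph_nat.
  transitivity (rC pi * iC R * tau * ratr (f%:R * `|DK d|%:~R * qform f a b c u v)).
    by rewrite [ratr (_ * qform _ _ _ _ _ _)]rmorphM /=; ring.
  by rewrite qE rmorphM /= rmorph_nat ratr_int; ring.
rewrite mulrA; congr (_ * _).
have h := sqrtD_neq0.
by field; rewrite h fC.
Qed.

(** [u_of] and [v_of] are Cramer's solution of the two equations in [theta_term]. *)
Definition u_of (p : int * int) : rat :=
  (2 * c * p.2 - b * p.1)%:~R / (f%:R * (4 * a * c - b ^+ 2)%:~R).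
Definition v_of (p : int * int) : rat :=
  (2 * a * p.1 - b * p.2)%:~R / (f%:R * (4 * a * c - b ^+ 2)%:~R).

Let fQ : f%:R != 0 :> rat. Proof. by rewrite pnatr_eq0 -lt0n. Qed.
Let EQ : 4 * a%:~R * c%:~R - b%:~R ^+ 2 != 0 :> rat.
Proof.
have -> : 4 * a%:~R * c%:~R - b%:~R ^+ 2 = (4 * a * c - b ^+ 2)%:~R :> rat.
  by rewrite rmorphB rmorphXn !rmorphM.
by rewrite intr_eq0; move: disc_lt0; lia.
Qed.

Lemma u_v_of1 p : f%:R * (b%:~R * u_of p + 2 * c%:~R * v_of p) = p.1%:~R.
Proof.
rewrite /u_of /v_of !(rmorphB, rmorphXn) !rmorphM /=.
by field; rewrite EQ fQ.
Qed.

Lemma u_v_of2 p : f%:R * (2 * a%:~R * u_of p + b%:~R * v_of p) = p.2%:~R.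
Proof.
rewrite /u_of /v_of !(rmorphB, rmorphXn) !rmorphM /=.
by field; rewrite EQ fQ.
Qed.

Lemma in_dual_of p : in_dual f a b c (u_of p) (v_of p).
Proof. by split; [exists p.2; exact: u_v_of2|exists p.1; exact: u_v_of1]. Qed.

(** Translating the dual vector by [(m, n)] moves [p] by [sub_disc (m, n)]. The square partial sums
    thus run over images of boxes under [psi], which exhaust the coset of [p]. *)
Lemma f_a_sum (tau : C) (p : int * int) l : upper tau ->
  chas_sum (fun q => if eqv f a b c q p then eterm z a b c tau q else 0) l ->
  f_a d f z a b c (u_of p) (v_of p) tau = kappa * l.
Proof.
move=> tu H; rewrite /f_a /theta_Omega; apply: cvgC_lim.
pose psi q := p + sub_disc f a b c q.
have psi_inj : injective psi by move=> q r /addrI /(sub_disc_inj f_gt0 disc_lt0).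
suff -> : (fun N : nat => \sum_(i < (2 * N).+1) \sum_(j < (2 * N).+1)
    let u := u_of p + ((i%:Z - N%:Z)%R)%:~R in
    let v := v_of p + ((j%:Z - N%:Z)%R)%:~R in
    Omega f z a u v * expC (rC pi * iC R * (rC (f%:R * `|DK d|%:~R) * tau) * ratr (qform f a b c u v)))
  = (fun N => kappa * \sum_(q <- map psi (zbox N)) if eqv f a b c q p then eterm z a b c tau q else 0).
  apply: cvgCM; apply: chas_sum_cvg H _ _ => [N|q].
    by rewrite map_inj_uniq // zbox_uniq.
  case: ifP => [/asboolP[r E] _|_]; last by rewrite eqxx.
  exists (maxn `|r.1|%N `|r.2|%N) => N; rewrite geq_max => rN.
  apply/mapP; exists r; first by rewrite mem_zbox.
  by rewrite /psi -E addrC subrK.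
apply/funext => N; rewrite big_map big_distrr /= /zbox big_allpairs_dep /=.
(* [zrange] enumerates [i - N] for [i <= 2 * N], as [theta_Omega] does, so the sums match term by
   term. *)
rewrite /zrange big_map -[iota 0 _]/(index_iota 0 (2 * N).+1) big_mkord.
apply: eq_bigr => i _; rewrite big_map big_mkord.
apply: eq_bigr => j _ /=.
set m := i%:Z - N%:Z; set n := j%:Z - N%:Z.
have -> : eqv f a b c (psi (m, n)) p.
  by apply/asboolP; exists (m, n); rewrite /psi addrC addKr.
apply: theta_term; rewrite /psi /=.
  have -> : forall U V : rat, f%:R * (b%:~R * (U + m%:~R) + 2 * c%:~R * (V + n%:~R)) =
    f%:R * (b%:~R * U + 2 * c%:~R * V) + f%:R * (b%:~R * m%:~R + 2 * c%:~R * n%:~R).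
    by move=> *; ring.
  by rewrite u_v_of1 !(rmorphD, rmorphM) /=; ring.
have -> : forall U V : rat, f%:R * (2 * a%:~R * (U + m%:~R) + b%:~R * (V + n%:~R)) =
  f%:R * (2 * a%:~R * U + b%:~R * V) + f%:R * (2 * a%:~R * m%:~R + b%:~R * n%:~R).
  by move=> *; ring.
by rewrite u_v_of2 !(rmorphD, rmorphM) /=; ring.
Qed.

Lemma levels_upto_cvg (tau : C) (P : pred (int * int)) l : upper tau ->
  chas_sum (fun q => if P q then eterm z a b c tau q else 0) l ->
  cvgC (fun N => \sum_(q <- levels_upto a b c N) if P q then eterm z a b c tau q else 0) l.
Proof.
move=> tu H; apply: chas_sum_cvg H _ _ => [N|p]; first exact: levels_upto_uniq.
case: ifP => _; last by rewrite eqxx.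
(* The origin lies in no level, but its term vanishes because of the factor lambda. *)
have [->|p0 _] := eqVneq p 0.
  by rewrite /eterm /lam /= mul0r addr0 mul0r eqxx.
have q0 := qf_gt0 zu Habc p0.
by exists `|qf a b c p|%N => N qN; rewrite (mem_levels_upto a_gt0 disc_lt0) q0 -(gtz0_abs q0).
Qed.

End ThetaOmega.

(** * Closure properties of the span F(Ell(O_K)) *)

Section Span.
Variable R : realType.
Local Notation C := (R[i]).
Variables (d : int) (zs : seq C).

Lemma in_F_Ell_ext (g g' : C -> C) : (forall tau, upper tau -> g tau = g' tau) ->
  in_F_Ell d zs g -> in_F_Ell d zs g'.
Proof.
move=> E [n [co [fr [idx [A [B [D [u [v [H1 H2]]]]]]]]]].
by exists n, co, fr, idx, A, B, D, u, v; split=> // tau tu; rewrite -E // H2.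
Qed.

Lemma in_F_Ell_f_a (x : C) f k a b c u v : (0 < f)%N -> (k < size zs)%N ->
  abc_of (nth 0 zs k) a b c -> in_dual f a b c u v ->
  in_F_Ell d zs (fun tau => x * f_a d f (nth 0 zs k) a b c u v tau).
Proof.
move=> f0 kz H1 H2.
exists 1%N, (fun=> x), (fun=> f), (fun=> k), (fun=> a), (fun=> b), (fun=> c), (fun=> u), (fun=> v).
by split=> // tau _; rewrite big_ord1.
Qed.

Lemma in_F_EllD (g g' : C -> C) : in_F_Ell d zs g -> in_F_Ell d zs g' ->
  in_F_Ell d zs (fun tau => g tau + g' tau).
Proof.
move=> [n [co [fr [idx [A [B [D [u [v [H1 H2]]]]]]]]]].
move=> [n' [co' [fr' [idx' [A' [B' [D' [u' [v' [H1' H2']]]]]]]]]].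
pose glue (T : Type) (x y : nat -> T) (k : nat) := if (k < n)%N then x k else y (k - n)%N.
exists (n + n')%N, (glue _ co co'), (glue _ fr fr'), (glue _ idx idx'), (glue _ A A'),
  (glue _ B B'), (glue _ D D'), (glue _ u u'), (glue _ v v'); split.
  move=> k kn; rewrite /glue; case: (ltnP k n) => h; first exact: H1.
  by apply: H1'; lia.
move=> tau tu; rewrite H2 // H2' // big_split_ord /=; congr (_ + _).
  by apply: eq_bigr => i _; rewrite /glue ltn_ord.
by apply: eq_bigr => i _; rewrite /glue ltnNge leq_addr /= addKn.
Qed.

Lemma in_F_Ell_sum (I : eqType) (r : seq I) (G : I -> C -> C) :
  (forall i, i \in r -> in_F_Ell d zs (G i)) ->
  in_F_Ell d zs (fun tau => \sum_(i <- r) G i tau).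
Proof.
elim: r => [|i r IH] H.
  exists 0%N, (fun=> 0), (fun=> 0%N), (fun=> 0%N), (fun=> 0), (fun=> 0), (fun=> 0), (fun=> 0), (fun=> 0).
  by split=> // tau _; rewrite big_nil big_ord0.
apply: (@in_F_Ell_ext (fun tau => G i tau + \sum_(j <- r) G j tau)).
  by move=> tau _; rewrite big_cons.
apply: in_F_EllD; first by apply: H; rewrite mem_head.
by apply: IH => j jr; apply: H; rewrite inE jr orbT.
Qed.

End Span.

(** * Assembly over all classes and cosets *)

Theorem theorem4p2p2 (R : realType) (d : int) (zs : seq R[i])
    (cf : set R[i]) (phi : set R[i] -> R[i]) :
  squarefree_neg d ->
  CM_reps d zs ->
  hecke_char d cf phi ->
  in_F_Ell d zs (hecke_theta d cf phi).
Proof.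
move=> d_sf zs_reps [[chi Hphi] _].
have cfI : int_ideal d cf by case: Hphi.
have zs_up k : (k < size zs)%N -> upper (nth 0 zs k) by case: zs_reps => H _ _ /H[].
have zs_CM k : (k < size zs)%N -> has_CM_OK d (nth 0 zs k) by case: zs_reps => H _ _ /H[].
have [[f|//] f0 cff] := ideal_posint d_sf cfI.
have f_gt0 : (0 < f)%N by lia.
have ex_abc k : exists x : int * int * int, (k < size zs)%N ->
    abc_of (nth 0 zs k) x.1.1 x.1.2 x.2.
  have [kz|kz] := ltnP k (size zs); last by exists (0, 0, 0).
  by have [a [b [c H]]] := CM_abc d_sf (zs_up k kz) (zs_CM k kz); exists (a, b, c).
have [abc Habc] := choice ex_abc.
pose A k := (abc k).1.1; pose B k := (abc k).1.2; pose D k := (abc k).2.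
have zs_abc k : (k < size zs)%N -> abc_of (nth 0 zs k) (A k) (B k) (D k) by exact: Habc.
have ex_Kg k : exists x : R[i] * (int * int -> R[i]), (k < size zs)%N ->
  (forall p : int * int, p != 0 ->
     Phi d cf phi (Jid (nth 0 zs k) (A k) p) = x.1 * (x.2 p * lam (nth 0 zs k) p)) /\
  (forall p q r : int * int, p != 0 -> q != 0 ->
     p - q = (f%:Z * r.1, f%:Z * r.2) -> x.2 p = x.2 q).
  have [kz|kz] := ltnP k (size zs); last by exists (0, fun=> 0).
  have [K [g H]] := Phi_class d_sf cfI Hphi (zs_up k kz) (zs_CM k kz) (zs_abc k kz) cff.
  by exists (K, g).
have [Kg HKg] := choice ex_Kg.
have [us [us_uniq us_size usP]] := units_finite R d_sf.
pose w : R[i] := (size us)%:R.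
have w0 : w != 0 by rewrite pnatr_eq0 -lt0n.
pose co k q : R[i] := if rep f (A k) (B k) (D k) q == q then (Kg k).2 q else 0.
pose kap k := kappa (nth 0 zs k) (A k) (B k) f.
(* The explicit combination: [w^-1] corrects for the units, [co] keeps one representative per coset,
   and dividing by [kap k] cancels the factor in [f_a_sum]. *)
apply: (@in_F_Ell_ext _ _ _ (fun tau => \sum_(k <- iota 0 (size zs))
   \sum_(q <- reps f (A k) (B k) (D k)) (w^-1 * (Kg k).1 * co k q / kap k) *
     f_a d f (nth 0 zs k) (A k) (B k) (D k)
        (u_of (A k) (B k) (D k) f q) (v_of (A k) (B k) (D k) f q) tau)); last first.
  apply: in_F_Ell_sum => k; rewrite mem_iota /= => kz; apply: in_F_Ell_sum => q _.
  apply: in_F_Ell_f_a => //; first exact: zs_abc.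
  exact: (in_dual_of d_sf (zs_up _ kz) (zs_CM _ kz) (zs_abc _ kz) f_gt0).
move=> tau tu; apply/esym; rewrite /hecke_theta; apply: cvgC_lim.
have [l Hl] : exists l : nat -> int * int -> R[i], forall k q, (k < size zs)%N ->
  chas_sum (fun p => if eqv f (A k) (B k) (D k) p q then eterm (nth 0 zs k) (A k) (B k) (D k) tau p else 0) (l k q).
  have H kq : exists l : R[i], (kq.1 < size zs)%N ->
    chas_sum (fun p => if eqv f (A kq.1) (B kq.1) (D kq.1) p kq.2 then
       eterm (nth 0 zs kq.1) (A kq.1) (B kq.1) (D kq.1) tau p else 0) l.
    have [kz|kz] := ltnP kq.1 (size zs); last by exists 0.
    have a0 : 0 < A kq.1 by case: (zs_abc _ kz).
    have D0 := zs_disc d_sf zs_reps zs_abc kz.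
    by have [x Hx] := eterm_sum (nth 0 zs kq.1) a0 D0 tu (fun p => eqv f (A kq.1) (B kq.1) (D kq.1) p kq.2); exists x.
  have [l Hl] := choice H; exists (fun k q => l (k, q)) => k q kz.
  exact: (Hl (k, q)).
(* Beyond the last class the sequence is constantly [l k q], so that [X k ^~ q] converges for every
   [k], as [cvgC_sum] asks. *)
pose X k N q := if (k < size zs)%N then \sum_(p <- levels_upto (A k) (B k) (D k) N)
   (if eqv f (A k) (B k) (D k) p q then eterm (nth 0 zs k) (A k) (B k) (D k) tau p else 0) else l k q.
(* An exact identity of partial sums: the coefficients of norm at most [N] are regrouped by class
   and coset before any limit is taken. *)
have EN N : \sum_(1 <= n < N.+1) hecke_coef d cf phi n * expC (rC (2 * pi) * iC R * tau * n%:R) =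
  \sum_(k <- iota 0 (size zs)) \sum_(q <- reps f (A k) (B k) (D k))
     (w^-1 * (Kg k).1 * co k q) * X k N q.
  transitivity (\sum_(1 <= n < N.+1) \sum_(k <- iota 0 (size zs)) \sum_(p <- level (A k) (B k) (D k) n)
      w^-1 * (Kg k).1 * ((Kg k).2 p * eterm (nth 0 zs k) (A k) (B k) (D k) tau p)).
    rewrite big_seq [RHS]big_seq; apply: eq_bigr => n; rewrite mem_index_iota => /andP[n0 _].
    have -> : hecke_coef d cf phi n = w^-1 * (hecke_coef d cf phi n * w) by rewrite mulrC mulfK.
    rewrite (hecke_coefE d_sf zs_reps zs_abc phi cfI n0 us_uniq usP).
    rewrite -(big_mkord xpredT (fun k => \sum_(p <- level (A k) (B k) (D k) n)
       Phi d cf phi (Jid (nth 0 zs k) (A k) p))) /index_iota subn0.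
    rewrite mulr_sumr mulr_suml big_seq [RHS]big_seq; apply: eq_bigr => k.
    rewrite mem_iota /= => kz; rewrite mulr_sumr mulr_suml big_seq [RHS]big_seq.
    apply: eq_bigr => p; rewrite mem_level; last exact: (zs_disc d_sf zs_reps zs_abc kz); last by case: (zs_abc _ kz).
    move=> /eqP qE; have p0 := qf_neq0 n0 qE.
    rewrite (proj1 (HKg k kz) p p0) /eterm qE -pmulrn; ring.
  rewrite exchange_big /= big_seq [RHS]big_seq; apply: eq_bigr => k; rewrite mem_iota /= => kz.
  have D0 := zs_disc d_sf zs_reps zs_abc kz.
  have a0 : 0 < A k by case: (zs_abc _ kz).
  rewrite -(big_map (level (A k) (B k) (D k)) xpredT (fun s => \sum_(p <- s)
      w^-1 * (Kg k).1 * ((Kg k).2 p * eterm (nth 0 zs k) (A k) (B k) (D k) tau p))).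
  rewrite -big_flatten /= -/(levels_upto (A k) (B k) (D k) N).
  rewrite /X kz; under [RHS]eq_bigr do rewrite big_distrr /=.
  rewrite exchange_big /= big_seq [RHS]big_seq; apply: eq_bigr => p.
  rewrite (mem_levels_upto a0 D0) => /andP[q0 _].
  have p0 : p != 0 by apply: contraTneq q0 => ->; rewrite /qf /=; lia.
  under eq_bigr do rewrite -mulrA.
  rewrite -big_distrr /=; congr (_ * _).
  apply/esym/(coset_expansion f_gt0 D0) => q r q0' E.
  exact: (proj2 (HKg k kz) p q r p0 q0' E).
under [X in cvgC X _]eq_fun do rewrite EN.
have -> : \sum_(k <- iota 0 (size zs)) \sum_(q <- reps f (A k) (B k) (D k))
   (w^-1 * (Kg k).1 * co k q / kap k) * f_a d f (nth 0 zs k) (A k) (B k) (D k)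
        (u_of (A k) (B k) (D k) f q) (v_of (A k) (B k) (D k) f q) tau =
   \sum_(k <- iota 0 (size zs)) \sum_(q <- reps f (A k) (B k) (D k))
     (w^-1 * (Kg k).1 * co k q) * l k q.
  rewrite big_seq [RHS]big_seq; apply: eq_bigr => k; rewrite mem_iota /= => kz.
  apply: eq_bigr => q _.
  rewrite (f_a_sum d_sf (zs_up _ kz) (zs_CM _ kz) (zs_abc _ kz) f_gt0 tu (Hl _ q kz)).
  have h : kap k != 0 := kappa_neq0 (zs_up _ kz) (zs_abc _ kz) f_gt0.
  by rewrite -/(kap k) mulrA divfK.
apply: cvgC_sum => k; apply: cvgC_sum => q; apply: cvgCM; rewrite /X.
have [kz|kz] := ltnP k (size zs); last exact: cvgC_cst.
by apply: (levels_upto_cvg d_sf (zs_up _ kz) (zs_CM _ kz) (zs_abc _ kz)) => //; exact: Hl.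
Qed.
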